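(* Let $G$ be a graph with $n$ vertices, $m$ edges and degree sequence $(d(v_1),\dots,d(v_n))$. For a hook partition $(k,1^{n-k})$ of $n$ write $$\operatorname{Imm}_{(k,1^{n-k})}(xI-L(G))=\sum_{r=0}^n(-1)^r c_r\,x^{n-r},\qquad c_r=c_{(k,1^{n-k}),r}(L(G)).$$ Then $$c_0=\binom{n-1}{k-1},\qquad c_1=F_1(G)\binom{n-1}{k-1}=2m\binom{n-1}{k-1},$$ $$c_2=F_2(G)\binom{n-1}{k-1}+\frac{(2k-n-1)m}{k-1}\binom{n-2}{k-2}\quad(n\ge3),$$ $$c_3=F_3(G)\binom{n-1}{k-1}+\frac{(2k-n-1)\mathcal{M}_3^1(G)}{k-1}\binom{n-2}{k-2}-2|\mathscr{C}_3(G)|\left[\binom{n-4}{k-4}-\binom{n-4}{k-1}\right]\quad(n\ge4),$$ $$\begin{aligned}c_4={}&F_4(G)\binom{n-1}{k-1}+\frac{(2k-n-1)\mathcal{M}_4^1(G)}{k-1}\binom{n-2}{k-2}-\mathcal{C}_4^3(G)\left[\binom{n-4}{k-4}-\binom{n-4}{k-1}\right]\\&+2|\mathscr{C}_4(G)|\left[\binom{n-5}{k-5}-\binom{n-5}{k-1}\right]\\&+\left[\binom m2-\sum_{i=1}^n\binom{d(v_i)}2\right]\left[\binom{n-5}{k-5}-2\binom{n-5}{k-3}+\binom{n-5}{k-1}\right]\quad(n\ge5),\end{aligned}$$ and $$\begin{aligned}c_5={}&F_5(G)\binom{n-1}{k-1}+\frac{(2k-n-1)\mathcal{M}_5^1(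G)}{k-1}\binom{n-2}{k-2}-2\mathcal{C}_5^3(G)\left[\binom{n-4}{k-4}+\binom{n-4}{k-1}\right]\\&+2\mathcal{C}_5^4(G)\left[\binom{n-5}{k-5}-\binom{n-5}{k-1}\right]+\mathcal{M}_5^2(G)\left[\binom{n-5}{k-5}-2\binom{n-5}{k-3}+\binom{n-5}{k-1}\right]\\&-2|\mathscr{C}_5(G)|\left[\binom{n-6}{k-6}-\binom{n-6}{k-1}\right]\\&-\sum_{j=1}^{|\mathscr{C}_3(G)|}2\big(m+3-\mathscr{T}_j(G)\big)\left[\binom{n-6}{k-6}+\binom{n-6}{k-3}-\binom{n-6}{k-4}-\binom{n-6}{k-1}\right]\quad(n\ge6).\end{aligned}$$
   Context: Graphs are finite and simple. $L(G)=D(G)-A(G)$ is the Laplacian matrix ($D(G)$ the diagonal degree matrix, $A(G)$ the adjacency matrix) of $G$, with vertices $v_1,\dots,v_n$ and degrees $d(v_i)$. For a partition $\lambda$ of $n$, $\chi_\lambda$ is the irreducible character of $\mathcal{S}_n$ indexed by $\lambda$ (so $(n)$ gives the trivial and $(1^n)$ the sign character), and $\operatorname{Imm}_\lambda(M)=\sum_{\sigma\in\mathcal{S}_n}\chi_\lambda(\sigma)\prod_{i=1}^n m_{i\sigma(i)}$ for an $n\times n$ matrix $M=[m_{ij}]$; the coefficients $c_{\lambda,r}(M)$ are defined by $\operatorname{Imm}_\lambda(xI_n-M)=\sum_{r=0}^n(-1)^r c_{\lambda,r}(M)x^{n-r}$. $F_r$ is the $r$th elementary symmetric function and $F_r(G)=F_r(d(v_1),\dots,d(v_n))$.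 $\mathscr{C}_l(G)$ is the set of cycles of length $l$ in $G$ and $\mathscr{M}_l(G)$ the set of $l$-matchings (sets of $l$ pairwise disjoint edges). For a cycle $C$ (resp. matching $\mathfrak{M}$), $\mathfrak{D}_C(G)$ (resp. $\mathfrak{D}_{\mathfrak{M}}(G)$) is the sequence of degrees (in $G$) of the vertices of $G$ not on $C$ (resp. not covered by $\mathfrak{M}$). Put $\mathcal{C}_r^l(G)=\sum_{C\in\mathscr{C}_l(G)}F_{r-l}(\mathfrak{D}_C(G))$ and $\mathcal{M}_r^l(G)=\sum_{\mathfrak{M}\in\mathscr{M}_l(G)}F_{r-2l}(\mathfrak{D}_{\mathfrak{M}}(G))$. The triangles in $\mathscr{C}_3(G)$ are numbered, and $\mathscr{T}_j(G)$ is the sum of the degrees of the three vertices of the $j$th triangle. Binomial coefficients follow the usual convention ($\binom ab=0$ if $b<0$ or $b>a\ge0$).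
   Formalization: Misprints corrected: the |C_3| bracket in c_3, the C_4^3 bracket in c_4 and the |C_5| bracket in c_5 have + instead of −, and the C_4^3 term in c_4 gets a factor 2; for k=1 the 0/0 factor binom(n-2,k-2)/(k-1) is read as 1/(n-1). *)

(* Defs.v *)
From HB Require Import structures.
From mathcomp Require Import all_boot all_order all_algebra.
From mathcomp Require Import all_fingroup all_solvable all_field all_character.

Set Implicit Arguments.
Unset Strict Implicit.
Unset Printing Implicit Defensive.

Import GroupScope Order.TTheory GRing.Theory Num.Theory.
Local Open Scope ring_scope.

Definition fiber_stab (n : nat) (f : 'I_n -> nat) : {set 'S_n} :=
  [set s : 'S_n | [forall i, f (s i) == f i]].

Lemma fiber_stab_group_set (n : nat) (f : 'I_n -> nat) :
  group_set (fiber_stab f).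
Proof.
apply/group_setP; split=> [|s t].
  by rewrite inE; apply/forallP=> i; rewrite perm1.
rewrite !inE => /forallP fs /forallP ft; apply/forallP=> i.
by rewrite permM (eqP (ft _)) fs.
Qed.

Canonical fiber_stab_group (n : nat) (f : 'I_n -> nat) :=
  Group (fiber_stab_group_set f).

(* The Young diagram of la is filled row by row with 0, ..., n-1, so that i lies
   in row [reshape_index la i] and column [reshape_offset la i].  The column
   stabiliser is a Young subgroup for the conjugate partition. *)
Definition row_stab (n : nat) (la : seq nat) : {group 'S_n} :=
  fiber_stab_group (fun i : 'I_n => reshape_index la i).

Definition col_stab (n : nat) (la : seq nat) : {group 'S_n} :=
  fiber_stab_group (fun i : 'I_n => reshape_offset la i).

Fact sign_cfun_subproof (n : nat) (G : {group 'S_n}) :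
  is_class_fun <<G>> [ffun s : 'S_n => (-1) ^+ odd_perm s *+ (s \in G) : algC].
Proof.
rewrite genGid; apply: intro_class_fun => [x y Gx Gy | x /negbTE-> //].
by rewrite groupJ // Gx odd_permJ.
Qed.

Definition sign_cfun (n : nat) (G : {group 'S_n}) : 'CF(G) :=
  Cfun 0 (sign_cfun_subproof G).

(* chi_la, for la a partition of n: the (unique) irreducible constituent common
   to the trivial character of the row stabiliser and the sign character of the
   column stabiliser, both induced to S_n (the definition of [la] in James and
   Kerber).  In particular la = (n) gives the trivial character and la = (1^n)
   the sign character. *)
Definition sym_char (n : nat) (la : seq nat) : 'CF([set: 'S_n]) :=
  if [pick i : Iirr [set: 'S_n] |
        (i \in irr_constt ('Ind[[set: 'S_n], row_stab n la] 1)) &&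
        (i \in irr_constt ('Ind[[set: 'S_n], col_stab n la]
                              (sign_cfun (col_stab n la))))]
  is Some i then 'chi_i else 0.

Definition immanant (n : nat) (la : seq nat) (R : comAlgType algC)
    (M : 'M[R]_n) : R :=
  \sum_(s : 'S_n) sym_char n la s *: \prod_(i < n) M i (s i).

Definition hook (n k : nat) : seq nat := k :: nseq (n - k) 1%N.

Definition deg (n : nat) (e : rel 'I_n) (i : 'I_n) : nat := #|[set j | e i j]|.

Definition laplacian (n : nat) (e : rel 'I_n) : 'M[algC]_n :=
  diag_mx (\row_i (deg e i)%:R) - \matrix_(i, j) (e i j)%:R.

Definition edges (n : nat) (e : rel 'I_n) : {set {set 'I_n}} :=
  [set [set p.1; p.2] | p : 'I_n * 'I_n & e p.1 p.2].

(* A cycle of length l >= 3 is identified with its set of edges. *)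
Definition cycles (n : nat) (e : rel 'I_n) (l : nat) : {set {set {set 'I_n}}} :=
  [set [set [set x; next s x] | x in s]
     | s : l.-tuple 'I_n & (2 < l)%N && ucycleb e s].

Definition matchings (n : nat) (e : rel 'I_n) (l : nat) :
    {set {set {set 'I_n}}} :=
  [set M : {set {set 'I_n}} | [&& M \subset edges e, trivIset M & #|M| == l]].

(* F_r of the family of degrees of the vertices in S. *)
Definition sym_deg (n : nat) (e : rel 'I_n) (r : nat) (S : {set 'I_n}) : nat :=
  (\sum_(A : {set 'I_n} | (A \subset S) && (#|A| == r)) \prod_(i in A) deg e i)%N.

(* The set [cover C] consists of the vertices of C, for C a set of edges.  The
   truncated subtractions are only meaningful for l <= r, resp. 2 * l <= r. *)
Definition cycle_sum (n : nat) (e : rel 'I_n) (r l : nat) : nat :=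
  (\sum_(C in cycles e l) sym_deg e (r - l) (~: cover C))%N.

Definition matching_sum (n : nat) (e : rel 'I_n) (r l : nat) : nat :=
  (\sum_(M in matchings e l) sym_deg e (r - 2 * l) (~: cover M))%N.

Definition deg_sum (n : nat) (e : rel 'I_n) (C : {set {set 'I_n}}) : nat :=
  (\sum_(i in cover C) deg e i)%N.

(* Zero when the lower argument is negative; negative upper arguments do not
   occur. *)
Definition binom (a b : int) : algC :=
  match a, b with
  | Posz a', Posz b' => 'C(a', b')%:R
  | _, _ => 0
  end.

(* 1/(k-1) * binom (n-2) (k-2) = (n-2)!/((k-1)! (n-k)!).  For k = 1 the left-hand
   side is 0/0 and is read as the right-hand side, that is as 1/(n-1); this is
   the value for which the formulas hold for the partition (1^n) too. *)
Definition binom_over_pred (n k : nat) : algC :=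
  if k == 1%N then (n%:R - 1)^-1
  else binom (n%:Z - 2) (k%:Z - 2) / (k%:R - 1).

(* The hook character (k, 1^(n-k)) takes, at a permutation of cycle type mu, the
   value of the coefficient of q^(n-k) in
     (1 + q)^-1 * \prod_i (1 - (- q)^mu_i).
   Hence it is binom (n-4) (k-4) + binom (n-4) (k-1) at a 3-cycle and
   binom (n-6) (k-6) + binom (n-6) (k-1) at a 5-cycle, with plus signs, and
   binom (n-5) (k-5) - binom (n-5) (k-1) at a 4-cycle, with a minus sign.
   Versions of the formulas for c_3, c_4 and c_5 with minus signs in the first
   two brackets, or without the factor 2 in front of the 3-cycle term of c_4,
   are incorrect: for n = 5, k = 2 and the disjoint union of a triangle and two
   isolated vertices, c_3 is 18, whereas the minus sign would give 22. *)

(* Main.v *)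
Require Import Defs.
From mathcomp Require Import all_boot all_order all_algebra.
From mathcomp Require Import all_fingroup all_solvable all_field all_character.
From mathcomp Require Import ring zify.

Set Implicit Arguments.
Unset Strict Implicit.
Unset Printing Implicit Defensive.

Import GroupScope Order.TTheory GRing.Theory Num.Theory.
Local Open Scope ring_scope.

(** The hook character.  Write n - k = j and let V be the permutation
    representation of S_n on C^n.  It splits as the trivial representation plus
    the standard one, so its exterior powers satisfy
      Lambda^j V = Lambda^j std + Lambda^(j-1) std,
    and the hook character is the character of Lambda^j std.  The character of
    Lambda^j V ([ext_char]) is induced from the sign character of the block of a
    j-set, taken on the setwise stabiliser of that set ([cfInd_block_sign]);
    inner products of two such characters reduce to counting orbits of a
    stabiliser on sets ([cfdot_ext_char], [sum_block_orbit]).  Consecutive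
    exterior powers share exactly one constituent, hence the alternating sums
    [hook_char] are virtual characters of norm 1 and positive degree, that is,
    irreducible ([hook_char_irr]).  The constituent that a hook diagram singles
    out is the same one: Lambda^j V and Lambda^(j+1) V sit below the characters
    induced from the row and the column stabiliser, and those two have a single
    common constituent because the row and column groups form only one double
    coset that contributes ([cfdot_Ind_Sym_hook], [sym_char_hook]).

    Its values.  A permutation s acts on the wedge of the basis vectors of an
    s-invariant set S by the sign of its restriction to S, and sends every other
    basis wedge to a different one up to sign;
      since invariant sets are unions of orbits,
    the generating function of the traces is the product over the orbits O of
    1 - (-X)^#|O| ([ext_fun_coef]).  Dividing by 1 + X gives the values of the
    hook character ([hook_char_coef]); reading off coefficients yields the
    brackets of binomial coefficients ([sym_char_one_cycle],
    [sym_char_two_cycles]).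

    The expansion.  In Imm(xI - L) the permutation s contributes chi(s) times the
    product of x - d(v) over its fixed points, provided that s moves every
    non-fixed point along an edge.  Hence c_r is the sum over such s, moving
    t <= r points, of (-1)^t chi(s) F_(r-t) of the degrees of the fixed points
    ([coef_immanant_laplacian]).  With t <= 5 only a few shapes occur: an
    involution is a matching ([sum_involutions_matchings]), a single cycle of
    length at least 3 is a cycle of the graph with one of its two orientations
    ([sum_one_cycles]), and the remaining type (3,2) is an oriented triangle with
    a disjoint edge ([card_type32]).  Double counting of incidences between
    vertices and edges turns the numbers of 2-matchings and of edges disjoint
    from a triangle into the stated closed forms ([card_matchings2],
    [card_edges_off_triangle]). *)

(** * Expansion of products over subsets *)

Lemma prodD_subsets (I : finType) (R : comNzRingType) (A : {set I})
    (F G : I -> R) :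
  \prod_(i in A) (F i + G i) =
  \sum_(J : {set I} | J \subset A) \prod_(i in J) F i * \prod_(i in A :\: J) G i.
Proof.
rewrite big_mkcond /= (eq_bigr (fun i => (if i \in A then F i else 0) +
  (if i \in A then G i else 1))) => [|i _]; last by case: ifP; rewrite ?add0r.
rewrite bigA_distr (bigID (fun J : {set I} => J \subset A)) /=.
rewrite [X in _ + X]big1 ?addr0 => [|J /subsetPn[i iJ iA]]; last first.
  by rewrite (bigD1 i) //= iJ (negPf iA) mul0r.
apply: eq_bigr => J /subsetP sJA.
rewrite [X in _ = X * _]big_mkcond [X in _ = _ * X]big_mkcond -big_split;
  apply: eq_bigr => i _ /=.
rewrite !inE; case: ifPn => [/sJA->|]; first by rewrite mulr1.
by rewrite mul1r.
Qed.

(** * The sign of a permutation on an invariant set *)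

Lemma restr_perm_if (T : finType) (S : {set T}) (s : {perm T}) x :
  s \in 'N(S | 'P) -> restr_perm S s x = if x \in S then s x else x.
Proof.
move=> sS; case: ifPn => xS; first exact: restr_permE.
by rewrite (out_perm (restr_perm_on S s)).
Qed.

Lemma stab_permP (T : finType) (S : {set T}) (s : {perm T}) :
  reflect (forall x, (s x \in S) = (x \in S)) (s \in 'N(S | 'P)).
Proof. by apply: (iffP astabsP) => H x; move: (H x); rewrite /= apermE. Qed.

Definition restr_sign (T : finType) (S : {set T}) (s : {perm T}) : algC :=
  (-1) ^+ odd_perm (restr_perm S s).

Lemma restr_sign1 (T : finType) (S : {set T}) : restr_sign S 1 = 1.
Proof. by rewrite /restr_sign morph1 odd_perm1. Qed.

Lemma restr_signM (T : finType) (S : {set T}) :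
  {in 'N(S | 'P) &, forall s t,
     restr_sign S (s * t)%g = restr_sign S s * restr_sign S t}.
Proof. by move=> s t sS tS; rewrite /restr_sign morphM // odd_permM signr_addb. Qed.

Lemma imset_perm (T : finType) (S : {set T}) (y : {perm T}) x :
  (x \in y @: S) = (y^-1%g x \in S).
Proof.
apply/imsetP/idP => [[z zS ->]|yS]; first by rewrite permK.
by exists (y^-1%g x); rewrite ?permKV.
Qed.

Lemma stab_permJ (T : finType) (S : {set T}) (s y : {perm T}) :
  (s ^ y \in 'N(y @: S | 'P))%g = (s \in 'N(S | 'P)).
Proof.
apply/stab_permP/stab_permP => H x; last first.
  by rewrite !imset_perm conjgE !permM permK H.
by have := H (y x); rewrite !imset_perm conjgE !permM !permK.
Qed.

Lemma restr_signJ (T : finType) (S : {set T}) (s y : {perm T}) :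
  s \in 'N(S | 'P) -> restr_sign (y @: S) (s ^ y)%g = restr_sign S s.
Proof.
move=> sS; rewrite /restr_sign -[in RHS](odd_permJ _ y); congr (_ ^+ odd_perm _).
apply/permP => x; rewrite restr_perm_if ?stab_permJ // imset_perm.
rewrite !conjgE !permM restr_perm_if //; case: ifP => // _.
by rewrite permKV.
Qed.

(** * Exterior powers of the permutation representation *)

(** Such a function is the trace of the representation by 1 x 1 matrices that it
    defines. *)
Lemma multiplicative_cfun_char (gT : finGroupType) (G : {group gT})
    (phi : 'CF(G)) :
  phi 1%g = 1 -> {in G &, {morph phi : x y / (x * y)%g >-> x * y}} ->
  phi \is a character.
Proof.
move=> phi1 phiM; pose r x : 'M[algC]_1 := (phi x)%:M.
have rP : mx_repr G r.
  by split=> [|x y Gx Gy]; rewrite /r ?phi1 ?phiM // -scalar_mxM.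
apply/char_reprP; exists (Representation (MxRepresentation rP)).
by apply/cfun_inP => x Gx; rewrite cfunE Gx mxtrace_scalar.
Qed.

(** Induction on the number of points of A outside B: a transposition of such a
    point with a point of B outside A lowers it. *)
Lemma perm_onto_set (T : finType) (A B : {set T}) :
  #|A| = #|B| -> exists y : {perm T}, y @: A = B.
Proof.
have [m] := ubnP #|A :\: B|; elim: m A => // m IH A ltm eqAB.
have [AB0 | [a aAB]] := set_0Vmem (A :\: B).
  exists 1%g; have sAB : A \subset B by rewrite -setD_eq0 AB0.
  rewrite (eq_imset _ (@perm1 _)) imset_id.
  by apply/eqP; rewrite eqEcard sAB eqAB /=.
have [b bBA] : exists b, b \in B :\: A.
  apply/set0Pn; rewrite -card_gt0.
  have := cardsID B A; have := cardsID A B; rewrite setIC eqAB => <- /addnI <-.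
  by rewrite card_gt0; apply/set0Pn; exists a.
move: aAB bBA; rewrite !inE => /andP[aB aA] /andP[bA bB].
pose A' := tperm a b @: A.
have cA' : #|A'| = #|B| by rewrite card_imset //; apply: perm_inj.
have {}/IH IH : (#|A' :\: B| < m)%N.
  rewrite -ltnS; apply: leq_trans ltm; rewrite ltnS; apply: proper_card.
  apply/properP; split; last first.
    by exists a; rewrite !inE ?aA ?aB // imset_perm tpermV tpermL (negPf bA) andbF.
  apply/subsetP => x; rewrite !inE imset_perm tpermV => /andP[xB].
  rewrite xB /=; have [->|xa] := eqVneq x a; first by rewrite tpermL (negPf bA).
  have [xb|xb] := eqVneq x b; first by rewrite xb bB in xB.
  by rewrite tpermD // eq_sym.
have [y yA'] := IH cA'.
exists (tperm a b * y)%g; rewrite -yA' /A' -imset_comp.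
by apply: eq_imset => x /=; rewrite permM.
Qed.

Fact restr_sign_subproof (T : finType) (S : {set T}) :
  is_class_fun <<'N(S | 'P)>>
    [ffun s : {perm T} => restr_sign S s *+ (s \in 'N(S | 'P))].
Proof.
rewrite genGid; apply: intro_class_fun => [x y Nx Ny | x /negbTE-> //].
rewrite groupJ // Nx -(restr_signJ y Nx); congr (restr_sign _ _ *+ _).
by apply/setP => z; rewrite imset_perm (stab_permP _ _ (groupVr Ny)).
Qed.

Definition block_sign (T : finType) (S : {set T}) : 'CF('N(S | 'P)) :=
  Cfun 0 (restr_sign_subproof S).

Lemma block_signE (T : finType) (S : {set T}) s :
  block_sign S s = restr_sign S s *+ (s \in 'N(S | 'P)).
Proof. by rewrite cfunE. Qed.

(** The trace of s on the j-th exterior power of the permutation representation: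
    in the basis of wedges indexed by j-sets, only s-invariant sets contribute to
    the diagonal, each with the sign of s on it. *)
Definition ext_fun (T : finType) (j : nat) (s : {perm T}) : algC :=
  \sum_(S : {set T} | (#|S| == j) && (s \in 'N(S | 'P))) restr_sign S s.

Fact ext_fun_subproof (T : finType) (j : nat) :
  is_class_fun <<[set: {perm T}]>> [ffun s : {perm T} => ext_fun j s].
Proof.
rewrite genGid; apply: intro_class_fun => [x y _ _ | x]; last by rewrite inE.
rewrite /ext_fun (reindex_onto (fun S : {set T} => y @: S)
                               (fun S : {set T} => y^-1%g @: S)) /=.
  apply: eq_big => [S|S].
    rewrite stab_permJ card_imset; last exact: perm_inj.
    rewrite -imset_comp (eq_imset _ (permK y)) imset_id eqxx andbT //.
  by move=> /andP[/andP[_]]; rewrite stab_permJ => /restr_signJ->.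
move=> S _; rewrite -imset_comp (eq_imset _ (permKV y)) imset_id //.
Qed.

Definition ext_char (T : finType) (j : nat) : 'CF([set: {perm T}]) :=
  Cfun 0 (ext_fun_subproof T j).

(** The permutations carrying S to S' form a coset of the stabiliser of S. *)
Lemma card_stab_transporter (T : finType) (S S' : {set T}) :
  #|S| = #|S'| -> #|[set y : {perm T} | y @: S == S']| = #|'N(S | 'P)|.
Proof.
move=> /perm_onto_set[y0 <-]; rewrite -(card_rcoset _ y0); apply: eq_card => y.
rewrite inE mem_rcoset; apply/eqP/stab_permP => [E x | E].
  by rewrite permM -imset_perm -E imset_perm permK.
by apply/setP => x; rewrite !imset_perm -E permM permKV.
Qed.

(** Conjugating by y replaces the pair (S, s) by (y S, s ^ y), so the induction
    formula sums the signs of s over the invariant translates of S; these are all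
    the sets of the size of S, each reached as often as the stabiliser of S has
    elements. *)
Lemma cfInd_block_sign (T : finType) (S : {set T}) :
  'Ind[[set: {perm T}]] (block_sign S) = ext_char T #|S|.
Proof.
apply/cfunP => s; rewrite cfIndE ?subsetT //.
rewrite cfunE /= /ext_fun (reindex_inj invg_inj) /=.
have E (y : {perm T}) : block_sign S (s ^ y^-1)%g =
    restr_sign (y @: S) s *+ (s \in 'N(y @: S | 'P)).
  have NE : (s ^ y^-1 \in 'N(S | 'P))%g = (s \in 'N(y @: S | 'P)).
    by rewrite -(stab_permJ S (s ^ y^-1)%g y) conjgKV.
  rewrite block_signE NE; case NS: (s \in _) => //.
  by rewrite -(restr_signJ y) ?conjgKV ?NE.
under eq_bigr => y _ do rewrite E.
rewrite (partition_big (fun y : {perm T} => y @: S) (fun S' => #|S'| == #|S|)) /=;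
  last by move=> y _; rewrite card_imset //; apply: perm_inj.
rewrite mulr_sumr [RHS]big_mkcondr /=; apply: eq_bigr => S' /eqP cS'.
rewrite (eq_bigr (fun _ => restr_sign S' s *+ (s \in 'N(S' | 'P)))); last first.
  by move=> y /andP[_ /eqP->].
rewrite (eq_bigl (mem [set y : {perm T} | y @: S == S'])) => [|y]; last first.
  by rewrite /= !inE.
rewrite sumr_const.
rewrite card_stab_transporter // -[_ *+ #|_|]mulr_natr mulrCA mulVf ?neq0CG //
  mulr1.
by case: (s \in _).
Qed.

Lemma block_sign_char (T : finType) (S : {set T}) : block_sign S \is a character.
Proof.
apply: multiplicative_cfun_char => [|s t sS tS].
  by rewrite block_signE group1 restr_sign1.
by rewrite !block_signE groupM ?sS ?tS // restr_signM.
Qed.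

Lemma exists_set_card (T : finType) i :
  (i <= #|T|)%N -> exists S : {set T}, #|S| = i.
Proof.
move=> le; exists [set x in take i (enum T)].
rewrite cardsE (card_uniqP _) ?take_uniq ?enum_uniq //.
by rewrite size_takel // -cardE.
Qed.

Lemma ext_char_char (T : finType) j : ext_char T j \is a character.
Proof.
have [/exists_set_card[S <-]|lt] := leqP j #|T|.
  by rewrite -cfInd_block_sign cfInd_char ?block_sign_char.
suff -> : ext_char T j = 0 by apply: cfun0_char.
apply/cfunP => s; rewrite !cfunE /= /ext_fun big1 // => S /andP[/eqP cS _].
by move: lt; rewrite -cS ltnNge max_card.
Qed.

(** * Inner products of exterior powers *)

(** The two lists of colours are rearrangements of each other, and a
    rearrangement of lists is a permutation of their index set. *)
Lemma perm_of_colouring (T : finType) (C : eqType) (f g : T -> C) :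
  (forall c, #|[pred x | f x == c]| = #|[pred x | g x == c]|) ->
  exists y : {perm T}, forall x, g (y x) = f x.
Proof.
move=> fg; have sz : size (map g (enum T)) == #|T| by rewrite size_map -cardE.
have fgP : perm_eq (map f (enum T)) (Tuple sz).
  apply/allP => c _ /=; rewrite !count_map -!size_filter; apply/eqP.
  by have := fg c; rewrite !cardE /enum_mem.
have /tuple_permP[p Ep] := fgP.
have inj : injective (fun x => enum_val (p (enum_rank x))).
  by move=> x1 x2 /enum_val_inj/perm_inj/enum_rank_inj.
exists (perm inj) => x; rewrite permE.
have := congr1 (fun s => nth (f x) s (enum_rank x)) Ep.
rewrite (nth_map x) -?cardE // nth_enum_rank => ->.
rewrite -[nat_of_ord _]/(val _) -tnth_nth tnth_mktuple (tnth_nth (f x)) /=.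
by rewrite (nth_map x) -?cardE // -enum_val_nth.
Qed.

Lemma sum_alternating (gT : finGroupType) (G : {group gT}) (f : gT -> algC) t :
  t \in G -> (forall s, s \in G -> f (t * s)%g = - f s) ->
  \sum_(s in G) f s = 0.
Proof.
move=> Gt ft; set X := \sum_(s in G) f s.
have : X = - X.
  rewrite {1}/X (reindex_inj (mulgI t)) /= -sumrN.
  by apply: eq_big => [s|s]; rewrite groupMl // => /ft.
by move/eqP; rewrite -addr_eq0 -mulr2n mulrn_eq0 /= => /eqP.
Qed.

Lemma restr_sign_tperm (T : finType) (S : {set T}) x y :
  x \in S -> y \in S -> x != y ->
  tperm x y \in 'N(S | 'P) /\ restr_sign S (tperm x y) = -1.
Proof.
move=> xS yS xy.
have N : tperm x y \in 'N(S | 'P).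
  by apply/stab_permP => z; case: tpermP => [->|->|]; rewrite ?xS ?yS.
split=> //; suff E : restr_perm S (tperm x y) = tperm x y.
  by rewrite /restr_sign E odd_tperm xy.
apply/permP => z; rewrite restr_perm_if //; case: ifPn => // zS.
by rewrite tpermD //; apply: contraNneq zS => <-.
Qed.

Lemma restr_sign_tperm_out (T : finType) (S : {set T}) x y :
  x \notin S -> y \notin S ->
  tperm x y \in 'N(S | 'P) /\ restr_sign S (tperm x y) = 1.
Proof.
move=> xS yS.
have N : tperm x y \in 'N(S | 'P).
  by apply/stab_permP => z; case: tpermP => [->|->|];
    rewrite ?(negPf xS) ?(negPf yS).
split=> //; suff E : restr_perm S (tperm x y) = 1%g.
  by rewrite /restr_sign E odd_perm1.
apply/permP => z; rewrite restr_perm_if // perm1; case: ifPn => // zS.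
by rewrite tpermD //; apply: contraTneq zS => <-.
Qed.

(** A transposition of two points of S outside S' is odd on S and trivial on S',
    so translation by it negates the summand. *)
Lemma sum_restr_sign2_far (T : finType) (S S' : {set T}) :
  (1 < #|S :\: S'|)%N ->
  \sum_(s in 'N(S | 'P) :&: 'N(S' | 'P)) restr_sign S s * restr_sign S' s = 0.
Proof.
move=> /card_gt1P[x [y [xS yS xy]]].
move: xS yS; rewrite !inE => /andP[xS' xS] /andP[yS' yS].
have [N1 e1] := restr_sign_tperm xS yS xy.
have [N2 e2] := restr_sign_tperm_out xS' yS'.
apply: (@sum_alternating _ _ _ (tperm x y)); first by rewrite inE N1.
move=> s /setIP[s1 s2]; rewrite !restr_signM // e1 e2 mul1r.
by rewrite mulN1r mulNr.
Qed.

(** A permutation preserving both sets fixes the point of S outside S', if any,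
    so that point does not affect the sign. *)
Lemma restr_sign_near (T : finType) (S S' : {set T}) s :
  (#|S :\: S'| <= 1)%N -> s \in 'N(S | 'P) -> s \in 'N(S' | 'P) ->
  restr_sign S s = restr_sign (S :&: S') s.
Proof.
move=> le1 NS NS'; congr (_ ^+ odd_perm _); apply/permP => x.
have /stab_permP PS := NS; have /stab_permP PS' := NS'.
rewrite !restr_perm_if //; last first.
  by apply/stab_permP => z; rewrite !inE PS PS'.
rewrite !inE; case: ifPn => //= xS; case: ifPn => // xS'.
by move/card_le1_eqP: le1; apply; rewrite !inE ?PS ?PS' ?xS ?xS'.
Qed.

Lemma sum_restr_sign2_near (T : finType) (S S' : {set T}) :
  (#|S :\: S'| <= 1)%N -> (#|S' :\: S| <= 1)%N ->
  \sum_(s in 'N(S | 'P) :&: 'N(S' | 'P)) restr_sign S s * restr_sign S' s =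
  #|'N(S | 'P) :&: 'N(S' | 'P)|%:R.
Proof.
move=> n1 n2; rewrite -sumr_const; apply: eq_bigr => s /setIP[NS NS'].
rewrite (restr_sign_near n1) // (restr_sign_near n2) // setIC.
by rewrite /restr_sign -signr_addb addbb.
Qed.

(** Orbit-stabiliser theorem for the stabiliser of S: its orbits on sets are
    described by the sizes of S' and of S minus S', because these determine the
    sizes of all four parts into which S and S' divide T. *)
Lemma sum_block_orbit (T : finType) (S S0 : {set T}) :
  (\sum_(S' : {set T} | (#|S'| == #|S0|) && (#|S :\: S'| == #|S :\: S0|))
     #|'N(S | 'P) :&: 'N(S' | 'P)| = #|'N(S | 'P)|)%N.
Proof.
rewrite -[RHS]sum1_card (partition_big (fun y : {perm T} => y @: S0)
  (fun S' => (#|S'| == #|S0|) && (#|S :\: S'| == #|S :\: S0|))) /=; last first.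
  move=> y yS; rewrite card_imset ?eqxx; last exact: perm_inj.
  rewrite -(card_imset (S :\: S0) (@perm_inj _ y)); apply/eqP/eq_card => x.
  by rewrite imset_perm !inE imset_perm (stab_permP _ _ (groupVr yS)).
apply: eq_bigr => S' /andP[/eqP c1 /eqP c2].
have [y yE] : exists y : {perm T}, forall x, (y x \in S, y x \in S') = (x \in
  S, x \in S0).
  apply: (perm_of_colouring (f := fun x => (x \in S, x \in S0))
    (g := fun x => (x \in S, x \in S'))) => -[b b'].
  (* The four parts into which S and S0, respectively S and S', divide T. *)
  have cI : #|S :&: S0| = #|S :&: S'|.
    by have := cardsID S0 S; rewrite -(cardsID S' S) c2 => /addIn.
  have cD : #|S0 :\: S| = #|S' :\: S|.
    by have := cardsID S S0; rewrite -c1 -(cardsID S S') !(setIC _ S) cI => /addnI.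
  have cU : #|S :|: S0| = #|S :|: S'|.
    by rewrite !cardsU cI c1.
  have cC : #|~: (S :|: S0)| = #|~: (S :|: S')|.
    have := cardsC (S :|: S0); rewrite -(cardsC (S :|: S')) cU => /addnI //.
  have conv (A B : {set T}) : #|[pred x | (x \in A, x \in B) == (b, b')]| =
     if b then (if b' then #|A :&: B| else #|A :\: B|)
          else (if b' then #|B :\: A| else #|~: (A :|: B)|).
    case: b b' => [] []; apply: eq_card => x; rewrite !inE xpair_eqE;
      by case: (x \in A); case: (x \in B).
  by rewrite !conv cI cD cC c2.
have yS : y \in 'N(S | 'P) by apply/stab_permP => x; case: (yE x).
have yS0 : y @: S0 = S'.
  by apply/setP => x; rewrite imset_perm; have := yE (y^-1%g x);
    rewrite permKV => -[_ ->].
rewrite sum1dep_card -(card_lcoset _ y); apply: eq_card => z.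
rewrite mem_lcoset [LHS]in_setI [RHS]in_set (groupMl z (groupVr yS)).
case zS: (z \in 'N(S | 'P)); last by [].
rewrite !andTb.
apply/stab_permP/eqP => [E | E x].
  apply/setP => x; rewrite imset_perm; have := E (y (z^-1%g x)).
  by rewrite permM permK permKV => ->; have [] := yE (z^-1%g x).
have ES u : (u \in S') = (z^-1%g u \in S0) by rewrite -E imset_perm.
by rewrite permM {1}ES permK -yS0 imset_perm.
Qed.

(** By Frobenius reciprocity the inner product is an average over the stabiliser
    of S of products of two signs.  For each S' this average vanishes as soon as
    S and S' differ by two points on the same side, and otherwise the signs
    cancel. *)
Lemma cfdot_ext_char (T : finType) (S : {set T}) j :
  '[ext_char T #|S|, ext_char T j] =
  #|'N(S | 'P)|%:R^-1 *
  (\sum_(S' : {set T} | [&& #|S'| == j, #|S :\: S'| <= 1 & #|S' :\: S| <= 1]%N)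
     #|'N(S | 'P) :&: 'N(S' | 'P)|)%:R.
Proof.
rewrite -cfInd_block_sign -cfdot_Res_r cfdotE; congr (_ * _).
rewrite natr_sum big_mkcondr /=.
under eq_bigr => s NS.
  rewrite block_signE NS mulr1n cfResE ?subsetT //.
  rewrite cfunE /= /ext_fun big_mkcondr raddf_sum mulr_sumr.
over.
rewrite exchange_big /=; apply: eq_bigr => S' _.
transitivity (\sum_(s in 'N(S | 'P) :&: 'N(S' | 'P)) restr_sign S s *
  restr_sign S' s).
  under [RHS]eq_bigl => s do rewrite in_setI.
  rewrite big_mkcondr; apply: eq_bigr => s NS; case: ifP;
    rewrite ?rmorph0 ?mulr0 //.
  by rewrite /restr_sign rmorph_sign.
have [n1|n1] := leqP; last by rewrite sum_restr_sign2_far.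
have [n2|n2] := leqP; first by rewrite sum_restr_sign2_near.
rewrite setIC; under eq_bigr => s _ do rewrite mulrC.
by rewrite sum_restr_sign2_far.
Qed.

(** * The hook characters are irreducible *)

Lemma sum_block_orbit_eq (T : finType) (S S0 : {set T}) (P : pred {set T}) :
  P =1 (fun S' : {set T} => (#|S'| == #|S0|) && (#|S :\: S'| == #|S :\: S0|)) ->
  (\sum_(S' : {set T} | P S') #|'N(S | 'P) :&: 'N(S' | 'P)| = #|'N(S | 'P)|)%N.
Proof. by move=> eqP; rewrite (eq_bigl _ _ eqP); apply: sum_block_orbit. Qed.

(** Two orbits contribute: the set S itself, and the sets obtained from it by
    exchanging one point; the second one is empty when S is. *)
Lemma cfdot_ext_char_diag (T : finType) i : (i < #|T|)%N ->
  '[ext_char T i] = 1 + (0 < i)%:R.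
Proof.
move=> ltiT; have [S cS] := exists_set_card (ltnW ltiT).
rewrite -{1}cS cfdot_ext_char; apply: canLR (mulKf (neq0CG _)) _.
have [y yS] : exists y, y \notin S.
  apply/existsP; rewrite -negb_forall; apply: contraTN ltiT => /forallP allS.
  rewrite -cS -leqNgt -cardsT subset_leq_card //; apply/subsetP => x _; exact: allS.
have eqD (S' : {set T}) : #|S'| = i -> #|S' :\: S| = #|S :\: S'|.
  move=> cS'; have := cardsID S S'; have := cardsID S' S.
  by rewrite cS cS' setIC => <- /addnI.
rewrite (bigID (fun S' => #|S :\: S'| == 0%N)) /=.
rewrite (@sum_block_orbit_eq _ _ S) => [|S']; last first.
  rewrite setDv cards0 cS; apply/andP/andP => [[/and3P[-> _ _] ->] //|[c1 c2]].
  by rewrite c1 c2 eqD ?(eqP c1) // (eqP c2).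
case: posnP => [i0|i_gt0].
  rewrite big1 ?addn0 ?addr0 ?mulr1 //= => S' /andP[_].
  by move: cS; rewrite i0 => /cards0_eq->; rewrite set0D cards0.
have [x xS] : exists x, x \in S by apply/set0Pn; rewrite -card_gt0 cS.
(* The second orbit is represented by S with x exchanged for y. *)
have cDx : #|S :\: (y |: (S :\ x))| = 1%N.
  rewrite -(cards1 x); apply: eq_card => z; rewrite !inE.
  have [->|_] := eqVneq z x; last by case: (z \in S); rewrite ?orbT ?andbF.
  by rewrite xS orbF andbT; apply: contraNneq yS => <-.
rewrite (@sum_block_orbit_eq _ _ (y |: (S :\ x))) => [|S'].
  by rewrite natrD mulrDr mulr1.
rewrite cDx cardsU1 !inE (negPf yS) andbF /=.
have := cardsD1 x S; rewrite cS xS => <-.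
apply/andP/andP => [[/and3P[-> le1 _] ne0]|[c1 c2]].
  by rewrite eqn_leq le1 lt0n ne0.
by rewrite c1 (eqP c2) eqD ?(eqP c1) ?(eqP c2).
Qed.

(** The only orbit that contributes consists of the sets S plus one point. *)
Lemma cfdot_ext_char_succ (T : finType) i : (i < #|T|)%N ->
  '[ext_char T i, ext_char T i.+1] = 1.
Proof.
move=> ltiT; have [S cS] := exists_set_card (ltnW ltiT).
rewrite -{1}cS cfdot_ext_char; apply: canLR (mulKf (neq0CG _)) _.
have [y yS] : exists y, y \notin S.
  apply/existsP; rewrite -negb_forall; apply: contraTN ltiT => /forallP allS.
  rewrite -cS -leqNgt -cardsT subset_leq_card //; apply/subsetP => x _; exact: allS.
rewrite mulr1 (@sum_block_orbit_eq _ _ (y |: S)) // => S'.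
have -> : #|S :\: (y |: S)| = 0%N.
  by apply/eqP; rewrite cards_eq0 setD_eq0 subsetUr.
rewrite cardsU1 yS cS /= add1n.
have := cardsID S S'; have := cardsID S' S; rewrite cS setIC.
case: (#|S'| =P i.+1) => //= -> <-; rewrite -addnS => /addnI->.
by rewrite ltnS leqn0 andbC; case: eqP => // ->.
Qed.

Lemma cfdot_ext_char_far (T : finType) i j : (i <= #|T|)%N -> (i.+1 < j)%N ->
  '[ext_char T i, ext_char T j] = 0.
Proof.
move=> leiT ltij; have [S cS] := exists_set_card leiT.
rewrite -{1}cS cfdot_ext_char big_pred0 ?mulr0 // => S'.
apply/and3P => -[/eqP cS' _ le1]; move: ltij; rewrite ltnNge -cS -cS'.
by rewrite -(cardsID S S') -addn1 leq_add // subset_leq_card ?subsetIr.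
Qed.

(** The character of the j-th exterior power of the standard representation:
    that of the permutation representation is the sum of the j-th and the
    (j-1)-st ones. *)
Fixpoint hook_char (T : finType) (j : nat) : 'CF([set: {perm T}]) :=
  if j is j'.+1 then ext_char T j'.+1 - hook_char T j' else ext_char T 0.

Lemma cfdot_ext_hook (T : finType) i j : (i <= #|T|)%N -> (j < #|T|)%N ->
  '[ext_char T i, hook_char T j] = ((i == j) + (i == j.+1))%:R.
Proof.
have tab a b : (a <= #|T|)%N -> (b < #|T|)%N -> '[ext_char T a, ext_char T b] =
   ((a == b) + (a == b.+1) + (a.+1 == b) + ((a == b) && (0 < a)%N))%:R.
  move=> lea ltb; case: (ltngtP a b) => [ltab|ltba|->].
  - rewrite ltn_eqF ?(leq_trans ltab) //= add0n addn0.
    case: eqP => [Eb|/eqP neb]; first by rewrite -Eb cfdot_ext_char_succ // Eb ltnW.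
    by rewrite cfdot_ext_char_far // ltn_neqAle neb.
  - rewrite [a.+1 == b]gtn_eqF ?ltnS ?(ltnW ltba) //= !addn0 add0n.
    rewrite cfdotC; case: eqP => [Ea|/eqP nea].
      by rewrite Ea cfdot_ext_char_succ ?rmorph1.
    by rewrite cfdot_ext_char_far ?rmorph0 ?(ltnW ltb) // ltn_neqAle eq_sym nea.
  - by rewrite cfdot_ext_char_diag // ltn_eqF // gtn_eqF // !addn0 natrD.
elim: j => [|j IH] lei ltj; rewrite /= ?tab //.
  by case: i lei => [|i] //= _; rewrite ?addn0.
rewrite cfdotBr IH ?(ltnW ltj) // tab // eqSS.
case: (eqVneq i j) => [->|ij]; first by rewrite ltn_eqF // ltn_eqF // subrr.
rewrite add0n addn0; case: (eqVneq i j.+1) => [->|ij1]; last by rewrite subr0 addn0.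
by rewrite ltn_eqF // addn0 natrD addrK.
Qed.

Lemma cfdot_hook_lt (T : finType) i j : (i < j)%N -> (j < #|T|)%N ->
  '[hook_char T i, hook_char T j] = 0.
Proof.
move=> ltij ltj; elim: i ltij => [|i IH] ltij /=.
  by rewrite cfdot_ext_hook // !ltn_eqF // ltnW.
rewrite cfdotBl cfdot_ext_hook // ?IH ?(ltnW ltij) ?(ltnW (ltn_trans ltij ltj)) //.
by rewrite !ltn_eqF ?subrr // ltnW.
Qed.

Lemma cfnorm_hook_char (T : finType) j : (j < #|T|)%N -> '[hook_char T j] = 1.
Proof.
move=> ltj; case: j ltj => [|j] ltj; first by rewrite cfdot_ext_hook.
rewrite cfdotBl cfdot_ext_hook ?(ltnW ltj) // cfdot_hook_lt // subr0.
by rewrite eqxx ltn_eqF.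
Qed.

Lemma hook_char1 (T : finType) j : (j < #|T|)%N ->
  hook_char T j 1%g = 'C(#|T|.-1, j)%:R.
Proof.
have ext1 i : ext_char T i 1%g = 'C(#|T|, i)%:R.
  rewrite cfunE /ext_fun -(card_draws T i) cardsE -sumr_const.
  by apply: eq_big => [S|S _]; rewrite ?group1 ?andbT // restr_sign1.
elim: j => [|j IH] ltj /=; first by rewrite ext1 !bin0.
have -> : (ext_char T j.+1 - hook_char T j) 1%g =
    ext_char T j.+1 1%g - hook_char T j 1%g by rewrite !cfunE.
rewrite ext1 IH ?(ltnW ltj) //.
by rewrite -(ltn_predK ltj) binS natrD addrK.
Qed.

Lemma hook_char_irr (T : finType) j : (j < #|T|)%N ->
  exists i, hook_char T j = 'chi_i.
Proof.
move=> ltj; have Z : hook_char T j \in 'Z[irr [set: {perm T}]].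
  elim: j {ltj} => [|j IH] /=; last rewrite rpredB //;
    by rewrite char_vchar ?ext_char_char.
have [b [i E]] := vchar_norm1P Z (cfnorm_hook_char ltj); exists i.
case: b E => //; rewrite ?scale1r // scaleN1r => E.
have Ei : 'chi_i = - hook_char T j by rewrite E opprK.
have := irr1_gt0 i; rewrite Ei cfunE hook_char1 //.
by rewrite oppr_gt0 ltrn0.
Qed.

(** * Identification of the hook character *)

(** Inducing in stages: a linear character is a constituent of what its
    restriction to a subgroup induces. *)
Lemma mem_Ind_Res_lin (gT : finGroupType) (G N H : {group gT})
    (lam : 'CF(N)) i :
  H \subset N -> N \subset G -> lam \is a linear_char ->
  '['Ind[G] lam, 'chi_i] != 0 -> i \in irr_constt ('Ind[G] ('Res[H] lam)).
Proof.
move=> sHN sNG lamL; rewrite -cfdot_Res_r => nz.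
have /irrP[t Et] := lin_char_irr lamL.
have tC : t \in irr_constt ('Res[N] 'chi_i).
  by rewrite irr_consttE cfdotC conjC_eq0 -Et.
have /(constt_charP _ (cfRes_char _ (irr_char i)))[chi chiC E] := tC.
have resL := cfRes_lin_char H lamL.
have /andP[resC /eqP res1] : ('Res[H] lam \is a character) && ('['Res[H] lam] == 1).
  by rewrite -irrEchar lin_char_irr.
rewrite irr_consttE -cfdot_Res_r -(cfResRes _ sHN sNG) E linearD /= -Et cfdotDr
  res1.
apply: lt0r_neq0; rewrite ltr_wpDr ?ltr01 // natr_ge0 // Cnat_cfdot_char //.
exact: cfRes_char.
Qed.

(** The sets A and B play the role of the first row and the first column of a
    hook, and z that of its corner.  If y maps a single point a of A into B, then
    it agrees on the rest of A with a permutation r of A that sends a to the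
    corner, and r^-1 y moves only points of B. *)
Lemma mem_Sym_hook (T : finType) (A B : {set T}) z (y : {perm T}) :
  A :&: B = [set z] -> A :|: B = [set: T] ->
  (#|A :&: y^-1%g @: B| <= 1)%N -> y \in (perm.Sym A * perm.Sym B)%g.
Proof.
move=> AB1 ABT le1.
have zA : z \in A by have := set11 z; rewrite -AB1 inE => /andP[].
have zB : z \in B by have := set11 z; rewrite -AB1 inE => /andP[].
have AB x : x \in A -> x \in B -> x = z.
  by move=> xA xB; apply/set1P; rewrite -AB1 inE xA.
have nA x : x \notin A -> x \in B.
  by move=> xA; have := in_setT x; rewrite -ABT inE (negPf xA).
have : #|A :&: y^-1%g @: B| != 0%N.
  have := cardsUI A (y^-1%g @: B); rewrite card_imset; last exact: perm_inj.
  rewrite -(cardsUI A B) AB1 ABT cards1 cardsT => E; apply: contra_eq_neq E => ->.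
  by rewrite addn0 addn1 neq_ltn ltnS max_card.
rewrite -lt0n card_gt0 => /set0Pn[a];
  rewrite !inE imset_perm invgK => /andP[aA yaB].
have ua x : x \in A -> y x \in B -> x = a.
  by move=> xA yxB; move/card_le1_eqP: le1; apply;
    rewrite !inE imset_perm invgK ?xA ?aA.
(* The permutation r; sending a to z keeps it a bijection of A. *)
pose f x := if x \in A then (if x == a then z else y x) else x.
have fA x : (f x \in A) = (x \in A).
  rewrite /f; case: (boolP (x \in A)) => [xA|/negPf->] //; case: eqVneq => // xa.
  by apply: contraT => /nA /ua; move/(_ xA)/eqP; rewrite (negPf xa).
have fz x : x \in A -> f x = z -> x = a.
  rewrite /f => xA; rewrite xA; case: eqVneq => // _ yz; apply: ua => //;
    by rewrite yz.
have f_inj : injective f.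
  move=> u v E; have := fA u; rewrite E fA => uv.
  case: (boolP (u \in A)) => uA; last by move: E; rewrite /f uv (negPf uA).
  move: (E); rewrite {2}/f uv uA; case: eqVneq => [va|va]; first by move/fz->.
  case: (eqVneq u a) => [ua'|ua']; last by rewrite /f uA (negPf ua') => /perm_inj.
  by move: E; rewrite {1}/f ua' aA eqxx => /esym/fz;
    rewrite uv uA => /(_ isT) /eqP; rewrite (negPf va).
apply/mulsgP; exists (perm f_inj) ((perm f_inj)^-1 * y)%g; last by rewrite mulKVg.
  rewrite inE; apply/subsetP => x; rewrite inE permE /f.
  by case: (x \in A); rewrite // eqxx.
rewrite inE; apply/subsetP => x; apply: contraR => xB.
have xA : x \in A by apply: contraNT xB => /nA.
have xz : x != z by apply: contraNneq xB => ->.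
rewrite permM; set u := (perm f_inj)^-1%g x;
  have fu : f u = x by rewrite -[f u](permE f_inj) permKV.
have uA : u \in A by rewrite -fA fu.
move: fu; rewrite /f uA; case: eqVneq => [_ zx|_ ->] //.
by rewrite zx eqxx in xz.
Qed.

(** Mackey's formula: a translate y contributes the sum of the signs of the row
    permutations that y conjugates into the column group.  A transposition among
    them makes this sum vanish, and without one there is only the identity; in that
    case y lies in the product of the two groups. *)
Lemma cfdot_Ind_Sym_hook (n : nat) (A B : {set 'I_n}) z (R C : {group 'S_n}) :
  A :&: B = [set z] -> A :|: B = [set: 'I_n] ->
  R :=: perm.Sym A -> C :=: perm.Sym B ->
  '['Ind[[set: 'S_n], R] 1, 'Ind[[set: 'S_n], C] (sign_cfun C)] <= 1.
Proof.
move=> AB ABT ER EC.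
rewrite -cfdot_Res_r cfdotE mulrC ler_pdivrMr ?gt0CG // mul1r.
pose E (y : 'S_n) := \sum_(r in R) ((-1) ^+ odd_perm r *+ (r ^ y \in C)%g : algC).
have -> : \sum_(r in R) (1 : 'CF(R)) r * (('Res[R] ('Ind[[set: 'S_n], C]
  (sign_cfun C))) r)^* =
   #|C|%:R^-1 * \sum_(y in [set: 'S_n]) E y.
  rewrite exchange_big mulr_sumr; apply: eq_bigr => r rR /=.
  rewrite cfun1E rR mul1r cfResE ?subsetT // cfIndE ?subsetT //.
  rewrite rmorphM fmorphV rmorph_nat rmorph_sum; congr (_ * _).
  apply: eq_bigr => y _; rewrite cfunE odd_permJ rmorphMn /=.
  by rewrite rmorph_sign.
rewrite mulrC ler_pdivrMr ?gt0CG // -natrM.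
have sgnE y : E y = (#|A :&: y^-1%g @: B| <= 1)%N%:R.
  case: leqP => [le1|/card_gt1P[u [v [+ + uv]]]].
    rewrite /E (bigD1 1%g) //= conj1g group1 odd_perm1 big1 ?addr0 // =>
      r /andP[rR r1].
    case: (boolP (r ^ y \in C)%g) => // rC; case/eqP: r1; apply/permP => x;
      rewrite perm1.
    apply/eqP; apply: contraTT rR => rx; rewrite ER inE.
    apply/negP => /subsetP rA; move: rC; rewrite EC inE => /subsetP rB.
    have memAB w : r w != w -> w \in A :&: y^-1%g @: B.
      move=> rw; rewrite inE rA ?inE // imset_perm invgK; apply: rB.
      by rewrite inE conjgE !permM permK (inj_eq perm_inj).
    have : r x = x.
      move/card_le1_eqP: le1; apply; apply: memAB => //.
      by rewrite (inj_eq perm_inj).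
    by move/eqP; rewrite (negPf rx).
  rewrite !inE !imset_perm !invgK => /andP[uA uB] /andP[vA vB].
  pose D := (R :&: C :^ (y^-1))%G.
  have -> : E y = \sum_(r in D) (-1) ^+ odd_perm r.
    rewrite /D /= [RHS](eq_bigl _ _ (fun r => in_setI r _ _)) big_mkcondr.
    by apply: eq_bigr => r _; rewrite mem_conjgV; case: (_ \in _).
  apply: (@sum_alternating _ _ _ (tperm u v)).
    rewrite inE mem_conjgV tpermJ ER EC !inE.
    apply/andP; split; apply/subsetP => w; rewrite inE; apply: contraR => wn;
      rewrite tpermD //; apply: contraNneq wn => <- //.
  by move=> r _; rewrite odd_permM odd_tperm uv signr_addb mulN1r.
rewrite (eq_bigr _ (fun y _ => sgnE y)) -natr_sum ler_nat mulnC.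
apply: leq_trans (_ : #|(R * C)%g| <= _)%N; last first.
  by rewrite mulnC mul_cardG leq_pmulr // cardG_gt0.
rewrite -sum1_card big_mkcond [X in (_ <= X)%N]big_mkcond leq_sum // => y _.
rewrite in_setT; case: (leqP #|_| 1) => // le1.
by rewrite ER EC (mem_Sym_hook AB ABT le1).
Qed.

Lemma hook_row_index n k i : (0 < k)%N -> (i < n)%N ->
  reshape_index (hook n k) i = if (i < k)%N then 0%N else (i - k).+1.
Proof.
move=> k0 ltin; rewrite /reshape_index /hook /= subn_eq0.
case: ltnP => // leki; congr _.+1; rewrite subSn //.
have : (i - k < n - k)%N by rewrite ltn_sub2r // (leq_ltn_trans leki).
elim: (n - k)%N (i - k)%N => {i k k0 ltin leki n} // m IH [|i] //= lti.
by rewrite subn1 /= IH.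
Qed.

Lemma hook_col_index n k i : (0 < k)%N -> (i < n)%N ->
  reshape_offset (hook n k) i = if (i < k)%N then i else 0%N.
Proof.
move=> k0 ltin; rewrite /reshape_offset hook_row_index //.
case: ltnP => leki; first by rewrite take0 subn0.
rewrite /hook /= take_nseq; last by rewrite leq_sub2r // ltnW.
by rewrite sumn_nseq mul1n subnKC // subnn.
Qed.

Lemma fiber_stab_Sym (n : nat) (f : 'I_n -> nat) (A : {set 'I_n}) :
  {in A &, forall i j, f i = f j} ->
  (forall i j, i \notin A -> f j = f i -> j = i) ->
  fiber_stab f = perm.Sym A.
Proof.
move=> fA fnA; apply/setP => s; rewrite !inE; apply/forallP/idP => [H|sA i].
  apply/subsetP => i; rewrite inE; apply: contraR => iA.
  by apply/eqP/fnA => //; apply/eqP/H.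
case: (boolP (i \in A)) => iA; last by rewrite (out_perm sA).
by apply/eqP/fA => //; rewrite perm_closed.
Qed.

Lemma block_sign_lin (T : finType) (S : {set T}) :
  block_sign S \is a linear_char.
Proof.
by rewrite qualifE /= block_sign_char block_signE group1 restr_sign1 /=.
Qed.

(** Restricting the sign of the block of the complement of the first row to the
    row group gives the trivial character, and restricting that of the first
    column to the column group gives the sign.  So the constituent common to two
    consecutive exterior powers is a constituent of both induced characters; it
    is the only common one, since two of them would make the inner product of
    the induced characters at least 2. *)
Lemma sym_char_hook (n k : nat) : (1 <= k <= n)%N ->
  sym_char n (hook n k) = hook_char 'I_n (n - k).
Proof.
move=> /andP[k0 lekn]; have n0 : (0 < n)%N by apply: leq_trans lekn.
pose A := [set i : 'I_n | (i < k)%N]; pose z : 'I_n := Ordinal n0.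
pose B := [set i : 'I_n | (i == z) || (k <= i)%N].
pose R := row_stab n (hook n k); pose C := col_stab n (hook n k).
have zA : z \in A by rewrite inE.
have AB : A :&: B = [set z].
  apply/setP => i; rewrite !inE ltnNge.
  by case: eqVneq => [->|_] /=; rewrite ?andNb // leqNgt k0.
have ABT : A :|: B = [set: 'I_n].
  by apply/setP => i; rewrite !inE; case: ltnP; rewrite ?orbT.
have ER : R :=: perm.Sym A.
  apply: fiber_stab_Sym => [i j|i j]; rewrite !inE !hook_row_index //.
    by move=> -> ->.
  rewrite -leqNgt => leki; rewrite [(i < k)%N]ltnNge leki /=.
  case: ltnP => // lekj [E]; apply/val_inj/eqP.
  by rewrite /= -(subnK lekj) E subnK.
have EC : C :=: perm.Sym B.
  apply: fiber_stab_Sym => [i j|i j]; rewrite !inE !hook_col_index //.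
    have B0 (u : 'I_n) : (u == z) || (k <= u)%N ->
      (if (u < k)%N then val u else 0%N) = 0%N.
      by case/orP => [/eqP->|]; [rewrite k0 | rewrite leqNgt => /negPf->].
    by move=> /B0-> /B0->.
  rewrite negb_or -ltnNge => /andP[iz ltik]; rewrite ltik.
  case: ltnP => [_|_ Ei]; first exact: val_inj.
  by case/eqP: iz; apply: val_inj; exact: esym Ei.
have cA : #|A| = k.
  have -> : A = [set widen_ord lekn i | i : 'I_k].
    apply/setP => i; rewrite inE; apply/idP/imsetP => [lti|[j _ ->]] //=.
    by exists (Ordinal lti) => //; apply: val_inj.
  by rewrite card_imset ?card_ord // => u v /(congr1 val)/= /val_inj.
have lj : (n - k < #|'I_n|)%N by rewrite card_ord ltn_subrL k0.
have [i Ei] := hook_char_irr lj.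
have iR : i \in irr_constt ('Ind[[set: 'S_n], R] 1).
  have cS : #|~: A| = (n - k)%N by rewrite -[n in RHS]card_ord -(cardsC A) cA addKn.
  have sR : R \subset 'N(~: A | 'P) by rewrite ER SymE astab_sub.
  have <- : 'Res[R] (block_sign (~: A)) = 1.
    apply/cfun_inP => r rR; rewrite cfResE // block_signE (subsetP sR) // cfun1E rR.
    suff -> : restr_sign (~: A) r = 1 by [].
    rewrite /restr_sign; suff -> : restr_perm (~: A) r = 1%g by rewrite odd_perm1.
    apply/permP => x; rewrite restr_perm_if ?(subsetP sR) // perm1.
    case: ifP => //; rewrite inE => xA; move: rR; rewrite ER inE => /out_perm-> //.
  apply: mem_Ind_Res_lin; rewrite ?subsetT ?block_sign_lin //.
  by rewrite cfInd_block_sign cS -Ei cfdot_ext_hook ?(ltnW lj) // eqxx ltn_eqF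
    // oner_eq0.
have iC : i \in irr_constt ('Ind[[set: 'S_n], C] (sign_cfun C)).
  have cS : #|B| = (n - k).+1.
    have := cardsUI A B; rewrite AB ABT cards1 cardsT card_ord cA => E.
    by rewrite -subSn // -addn1 E addKn.
  have sC : C \subset 'N(B | 'P).
    apply/subsetP => c; rewrite EC inE => cB; apply/stab_permP => x.
    exact: perm_closed.
  have <- : 'Res[C] (block_sign B) = sign_cfun C.
    apply/cfun_inP => r rC; rewrite cfResE // block_signE (subsetP sC) // cfunE rC.
    rewrite /restr_sign; congr (_ ^+ odd_perm _).
    apply/permP => x; rewrite restr_perm_if ?(subsetP sC) //.
    by case: ifPn => // xB; move: rC; rewrite EC inE => /out_perm->.
  apply: mem_Ind_Res_lin; rewrite ?subsetT ?block_sign_lin //.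
  by rewrite cfInd_block_sign cS -Ei cfdot_ext_hook // gtn_eqF ?eqxx ?oner_eq0.
have chR : 'Ind[[set: 'S_n], R] 1 \is a character by rewrite cfInd_char ?cfun1_char.
have chC : 'Ind[[set: 'S_n], C] (sign_cfun C) \is a character.
  rewrite cfInd_char //; apply: multiplicative_cfun_char => [|s t sC tC].
    by rewrite cfunE group1 odd_perm1.
  by rewrite !cfunE groupM ?sC ?tC // odd_permM signr_addb.
rewrite Ei /sym_char; case: pickP => [i' /andP[iR' iC']|/(_ i)]; last first.
  by rewrite -/R -/C iR iC.
case: (eqVneq i' i) => [->//|ii'].
have := cfdot_Ind_Sym_hook AB ABT ER EC.
rewrite cfdot_char_r // (bigD1 i) //= (bigD1 i') //= addrA.
have ge1 a (phi : 'CF([set: 'S_n])) : phi \is a character -> a \in irr_constt phi ->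
  1 <= '[phi, 'chi_a].
  move=> chphi; rewrite irr_consttE => nz.
  by have /natrP[m E] := Cnat_cfdot_char_irr a chphi; move: nz;
    rewrite E pnatr_eq0 ler1n lt0n.
have ge2 : 1 + 1 <= '['Ind[[set: 'S_n], R] 1, 'chi_i] * '['Ind[[set: 'S_n], C]
  (sign_cfun C), 'chi_i] +
    '['Ind[[set: 'S_n], R] 1, 'chi_i'] * '['Ind[[set: 'S_n], C] (sign_cfun C),
      'chi_i'].
  by rewrite lerD // -[1]mulr1 ler_pM ?ler01 ?ge1.
move=> /(le_trans (lerD ge2 _)) H.
have : (1 + 1 + 0 : algC) <= 1.
  apply: H; apply: sumr_ge0 => a _; apply: mulr_ge0; apply: natr_ge0;
    exact: Cnat_cfdot_char_irr.
by rewrite addr0 gerDl ler10.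
Qed.

(** * Values of the hook characters *)

Lemma trivIset_porbits (T : finType) (s : {perm T}) : trivIset (porbits s).
Proof.
apply/trivIsetP => _ _ /imsetP[x _ ->] /imsetP[y _ ->].
apply: contraR => /pred0Pn[z /andP[/= zx zy]].
by rewrite -eq_porbit_mem in zx; rewrite -eq_porbit_mem in zy; rewrite -(eqP zx).
Qed.

Lemma cover_porbits (T : finType) (s : {perm T}) : cover (porbits s) = [set: T].
Proof.
apply/setP => x; rewrite inE; apply/bigcupP; exists (porbit s x);
  last exact: porbit_id.
by apply/imsetP; exists x.
Qed.

Lemma porbit_sub_stab (T : finType) (S : {set T}) (s : {perm T}) x :
  s \in 'N(S | 'P) -> (porbit s x \subset S) = (x \in S).
Proof.
move=> sS; apply/idP/idP => [/subsetP|xS]; first by apply; apply: porbit_id.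
apply/subsetP => _ /porbitP[i ->].
by rewrite (stab_permP _ _ (groupX i sS)).
Qed.

(** A cycle of length l has sign (-1)^(l-1). *)
Lemma sign_perm_porbits (T : finType) (s : {perm T}) :
  (-1) ^+ odd_perm s = \prod_(O in porbits s) (- (-1) ^+ #|O|) :> algC.
Proof.
rewrite (eq_bigr (fun O : {set T} => (-1) ^+ (1 + #|O|)%N)) => [|O _]; last first.
  by rewrite exprS mulN1r.
rewrite prodrXr big_split /= sum1_card (eqP (trivIset_porbits s)).
by rewrite cover_porbits cardsT /odd_perm -oddD signr_odd addnC.
Qed.

Lemma restr_sign_porbits (T : finType) (S : {set T}) (s : {perm T}) :
  s \in 'N(S | 'P) ->
  restr_sign S s =
  \prod_(O in porbits s | O \subset S) (- (-1) ^+ #|O|).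
Proof.
move=> sS; rewrite /restr_sign sign_perm_porbits; set t := restr_perm S s.
have tS : t \in 'N(S | 'P).
  by apply/stab_permP => x; apply: perm_closed; apply: restr_perm_on.
have tE x : x \in S -> porbit t x = porbit s x.
  move=> xS; have it i : (t ^+ i)%g x = (s ^+ i)%g x.
    elim: i => [|i IH]; first by rewrite !expg0.
    rewrite !expgSr !permM IH restr_perm_if //.
    by rewrite (stab_permP _ _ (groupX i sS)) xS.
  by apply/setP => y; apply/porbitP/porbitP => -[i ->]; exists i; rewrite it.
have tO x : x \notin S -> porbit t x = [set x].
  move=> xS; have it i : (t ^+ i)%g x = x.
    elim: i => [|i IH]; first by rewrite !expg0 perm1.
    by rewrite expgSr permM IH restr_perm_if // (negPf xS).
  apply/setP => y; rewrite inE; apply/porbitP/eqP => [[i ->] //|->].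
  by exists 0%N; rewrite expg0 perm1.
rewrite (bigID (fun O : {set T} => O \subset S)) /= [X in _ * X]big1 ?mulr1;
  last first.
  move=> _ /andP[/imsetP[x _ ->]]; rewrite porbit_sub_stab // => /tO->.
  by rewrite cards1 expr1 opprK.
apply: eq_bigl => O; apply/andP/andP => -[/imsetP[x _ ->]];
  rewrite porbit_sub_stab // => xS.
  by rewrite tE //; split=> //; apply/imsetP; exists x.
by rewrite -tE //; split=> //; apply/imsetP; exists x.
Qed.

(** Expanding the product chooses a set of orbits, and these choices correspond
    to the invariant sets: X records the size of the union and the coefficient is
    the sign on it. *)
Lemma ext_fun_coef (T : finType) j (s : {perm T}) :
  ext_char T j s = (\prod_(O in porbits s) (1 - (- 'X) ^+ #|O|) : {poly algC})`_j.
Proof.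
rewrite cfunE /ext_fun.
pose F (O : {set T}) : {poly algC} := (- (-1) ^+ #|O|)%:P * 'X^#|O|.
rewrite (eq_bigr (fun O : {set T} => F O + 1)) => [|O _]; last first.
  by rewrite /F (exprNn 'X) polyCN polyC_exp polyCN polyC1 mulNr addrC.
rewrite (prodD_subsets _ F (fun=> 1)) coef_sum.
transitivity (\sum_(J : {set {set T}} | (J \subset porbits s) && (#|cover J| == j))
    \prod_(O in J) - (-1) ^+ #|O| : algC); last first.
  rewrite big_mkcondr; apply: eq_bigr => J sJ.
  rewrite [X in _ * X]big1 // mulr1 big_split /= -rmorph_prod prodrXr /=.
  rewrite (eqP (trivIsetS sJ (trivIset_porbits s))) coefCM coefXn eq_sym.
  by case: eqP; rewrite ?mulr1 ?mulr0.
pose orb (S : {set T}) := [set O in porbits s | O \subset S].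
have coverK (S : {set T}) : s \in 'N(S | 'P) -> cover (orb S) = S.
  move=> sS; apply/setP => x; apply/bigcupP/idP => [[O]|xS].
    by rewrite inE => /andP[_ /subsetP]; apply.
  exists (porbit s x); last exact: porbit_id.
  by rewrite inE porbit_sub_stab // xS andbT; apply/imsetP; exists x.
have orbK (J : {set {set T}}) : J \subset porbits s -> orb (cover J) = J.
  move=> /subsetP sJ; apply/setP => O; rewrite inE; apply/andP/idP => [[]|OJ];
    last first.
    by split; [apply: sJ | apply: (bigcup_sup O)].
  move=> /imsetP[x _ ->] /subsetP/(_ x (porbit_id s x))/bigcupP[O' O'J xO'].
  move: (O'J) => /sJ/imsetP[y _ EO']; move: xO';
    rewrite EO' -eq_porbit_mem => /eqP->.
  by rewrite -EO'.
have coverN (J : {set {set T}}) : J \subset porbits s -> s \in 'N(cover J | 'P).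
  move=> /subsetP sJ; apply/stab_permP => x.
  have H u v : u \in porbit s v -> v \in cover J -> u \in cover J.
    move=> uv /bigcupP[O OJ vO]; apply/bigcupP; exists O => //.
    move: (OJ) vO => /sJ/imsetP[y _ ->]; rewrite -!eq_porbit_mem => /eqP <-.
    by rewrite eq_porbit_mem.
  apply/idP/idP; apply: H; last exact: (mem_porbit s 1).
  by rewrite porbit_sym; exact: (mem_porbit s 1).
rewrite (reindex_onto (fun J : {set {set T}} => cover J) orb) /=; last first.
  by move=> S /andP[_ sS]; rewrite coverK.
apply: eq_big => [J|J].
  apply/andP/andP => [[/andP[-> _] /eqP <-]|[sJ ->]];
    last by rewrite coverN // orbK.
  by split=> //; apply/subsetP => O; rewrite inE => /andP[].
move=> /andP[/andP[_ sS] /eqP EJ]; rewrite restr_sign_porbits //.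
by rewrite -{2}EJ; apply: eq_bigl => O; rewrite inE.
Qed.

Definition supp (T : finType) (s : {perm T}) : {set T} := [set x | s x != x].

Definition cycles_of (T : finType) (s : {perm T}) : {set {set T}} :=
  [set O in porbits s | (1 < #|O|)%N].

Lemma card_porbit_gt1 (T : finType) (s : {perm T}) x :
  (1 < #|porbit s x|)%N = (s x != x).
Proof.
apply/idP/idP => [|nfix]; last first.
  apply/card_gt1P; exists x, (s x); split; rewrite ?porbit_id 1?eq_sym //.
  exact: (mem_porbit s 1).
apply: contraTneq => fx; rewrite -leqNgt; apply/card_le1_eqP => y z.
have it i : (s ^+ i)%g x = x.
  by elim: i => [|i IH]; rewrite ?expg0 ?perm1 // expgSr permM IH.
by move=> /porbitP[i ->] /porbitP[k ->]; rewrite !it.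
Qed.

Lemma cover_cycles_of (T : finType) (s : {perm T}) : cover (cycles_of s) = supp s.
Proof.
apply/setP => x; rewrite inE; apply/bigcupP/idP => [[O]|xs].
  rewrite inE => /andP[/imsetP[y _ ->]]; rewrite -eq_porbit_mem => gt1 /eqP E.
  by rewrite -card_porbit_gt1 E.
exists (porbit s x); last exact: porbit_id.
by rewrite inE card_porbit_gt1 xs andbT; apply/imsetP; exists x.
Qed.

Lemma trivIset_cycles_of (T : finType) (s : {perm T}) : trivIset (cycles_of s).
Proof. by apply: trivIsetS (trivIset_porbits s); apply/subsetP => O;
  rewrite inE => /andP[]. Qed.

Lemma sum_card_cycles_of (T : finType) (s : {perm T}) :
  (\sum_(O in cycles_of s) #|O| = #|supp s|)%N.
Proof. by rewrite (eqP (trivIset_cycles_of s)) cover_cycles_of. Qed.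

Lemma card_fixed_porbits (T : finType) (s : {perm T}) :
  #|porbits s :\: cycles_of s| = (#|T| - #|supp s|)%N.
Proof.
have -> : porbits s :\: cycles_of s = [set [set x] | x in ~: supp s].
  apply/setP => O; apply/setDP/imsetP => [[/imsetP[x _ ->]]|[x]].
    rewrite inE imset_f // card_porbit_gt1 => /negbNE fx.
    exists x; first by rewrite !inE negbK.
    apply/eqP; rewrite eq_sym eqEcard sub1set porbit_id cards1 leqNgt
      card_porbit_gt1.
    by rewrite negbK.
  rewrite !inE negbK => /eqP fx ->; have -> : [set x] = porbit s x.
    apply/eqP; rewrite eqEcard sub1set porbit_id cards1 leqNgt card_porbit_gt1 fx.
    by rewrite eqxx.
  by rewrite imset_f // card_porbit_gt1 fx eqxx.
rewrite card_imset; last exact: set1_inj.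
by rewrite -(cardsC (supp s)) addKn.
Qed.

(** The recursion defining [hook_char] is division of the generating function by
    1 + X.  This division is exact because each fixed point contributes a factor
    1 + X and there is at least one fixed point. *)
Lemma hook_char_coef (T : finType) j (s : {perm T}) : (#|supp s| < #|T|)%N ->
  hook_char T j s =
  ((1 + 'X) ^+ (#|T| - #|supp s|).-1 *
    \prod_(O in cycles_of s) (1 - (- 'X) ^+ #|O|) : {poly algC})`_j.
Proof.
move=> lt; set Q := (X in X`_j).
have E i : ext_char T i s = Q`_i + ('X * Q)`_i.
  rewrite ext_fun_coef -coefD -[X in X + _]mul1r -mulrDl.
  congr ((polyseq _)`_i); rewrite mulrA -exprS prednK ?subn_gt0 //
    -card_fixed_porbits.
  rewrite (big_setID (cycles_of s)) /= mulrC.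
  rewrite (_ : porbits s :&: cycles_of s = cycles_of s); last first.
    by apply/setP => O; rewrite !inE andbA andbb.
  rewrite -prodr_const; congr (_ * _).
  apply: eq_bigr => O /setDP[Op]; rewrite inE Op /= => O1.
  have -> : #|O| = 1%N.
    apply/eqP; rewrite eqn_leq leqNgt O1 /=; case/imsetP: Op => x _ ->.
    by rewrite lt0n card_porbit_neq0.
  by rewrite expr1 opprK.
elim: j => [|j IH] /=; first by rewrite E coefXM addr0.
have -> : (ext_char T j.+1 - hook_char T j) s = ext_char T j.+1 s - hook_char T j s.
  by rewrite !cfunE.
by rewrite E IH coefXM addrK.
Qed.

(** * Values as binomial coefficients *)

Lemma coef_add1X (m i : nat) : ((1 + 'X) ^+ m : {poly algC})`_i = 'C(m, i)%:R.
Proof.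
rewrite exprDn coef_sum.
under eq_bigr => j _ do rewrite expr1n mul1r coefMn coefXn.
have [lt|le] := ltnP i m.+1.
  rewrite (bigD1 (Ordinal lt)) //= eqxx big1 ?addr0 // => j.
  by rewrite -val_eqE /= eq_sym => /negPf->; rewrite mul0rn.
rewrite big1 ?bin_small // => j _.
by rewrite gtn_eqF ?mul0rn // (leq_trans (ltn_ord j)).
Qed.

Lemma binomE (n k a b : nat) : (a <= n)%N ->
  binom (n%:Z - a%:Z) (k%:Z - b%:Z) = if (b <= k)%N then 'C(n - a, k - b)%:R else 0.
Proof.
move=> le; rewrite subzn //; case: leqP => [le2|lt2]; first by rewrite subzn.
have -> : k%:Z - b%:Z = Negz (b - k).-1 by rewrite NegzE; lia.
by [].
Qed.

(** The coefficient of index n - k - a is turned into one of index k - b by the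
    symmetry of binomial coefficients; an index out of range on one side is out of
    range on the other. *)
Lemma coef_Xn_add1X (n k a b m : nat) : (a + b + m = n)%N -> (k <= n)%N ->
  ('X^a * (1 + 'X) ^+ m : {poly algC})`_(n - k) =
  binom (n%:Z - (a + b)%:Z) (k%:Z - b%:Z).
Proof.
move=> En lekn; rewrite binomE ?coefXnM ?coef_add1X; last by lia.
have Em : (n - (a + b) = m)%N by lia.
rewrite Em; case: (ltnP (n - k) a) => lta; case: (leqP b k) => ltb //.
- by rewrite bin_small //; lia.
- by rewrite -[in RHS]bin_sub; [congr ('C(_, _)%:R) | ]; lia.
by rewrite bin_small //; lia.
Qed.

Lemma cycles_of_card_ge2 (T : finType) (s : {perm T}) :
  (#|cycles_of s| * 2 <= #|supp s|)%N.
Proof.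
rewrite -sum_card_cycles_of -sum_nat_const; apply: leq_sum => O.
by rewrite inE => /andP[].
Qed.

Lemma cycles_of_eq0 (T : finType) (s : {perm T}) :
  (#|cycles_of s| == 0%N) = (#|supp s| == 0%N).
Proof.
apply/eqP/eqP => [/cards0_eq E|E];
  first by rewrite -cover_cycles_of E /cover big_set0 cards0.
by have := cycles_of_card_ge2 s; rewrite E leqn0 muln_eq0 orbF => /eqP.
Qed.

Lemma cycles_of_single (T : finType) (s : {perm T}) : #|cycles_of s| = 1%N ->
  cycles_of s = [set supp s].
Proof. by move/eqP/cards1P => [O E]; rewrite -cover_cycles_of E cover1. Qed.

Lemma prod_single_cycle (T : finType) (R : comNzRingType) (F : nat -> R)
    (s : {perm T}) : #|cycles_of s| = 1%N ->
  \prod_(O in cycles_of s) F #|O| = F #|supp s|.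
Proof. by move/cycles_of_single->; rewrite big_set1. Qed.

Lemma prod_two_cycles (T : finType) (R : comNzRingType) (F : nat -> R)
    (s : {perm T}) : #|cycles_of s| = 2%N -> (#|supp s| <= 5)%N ->
  \prod_(O in cycles_of s) F #|O| = F 2%N * F (#|supp s| - 2)%N.
Proof.
move=> /eqP/cards2P[O1 [O2 [O12 E]]] le5.
have O1s : O1 \in cycles_of s by rewrite E !inE eqxx.
have O2s : O2 \in cycles_of s by rewrite E !inE eqxx orbT.
move: le5 O1s O2s; rewrite -sum_card_cycles_of !inE E =>
  le5 /andP[_ c1] /andP[_ c2].
rewrite big_setU1 ?inE // big_set1 /=;
  rewrite big_setU1 ?inE // big_set1 /= in le5 *.
have [c|c] : (#|O1| = 2 \/ #|O2| = 2)%N by lia.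
  by rewrite c addKn.
by rewrite c addnK mulrC.
Qed.


Lemma sym_char_one_cycle n k (s : 'S_n) (l : nat) : (1 <= k <= n)%N ->
  #|cycles_of s| = 1%N -> #|supp s| = l -> (l < n)%N ->
  sym_char n (hook n k) s =
  binom (n%:Z - l.+1%:Z) (k%:Z - l.+1%:Z) -
  (-1) ^+ l * binom (n%:Z - l.+1%:Z) (k%:Z - 1%:Z).
Proof.
move=> kn c1 cs ltln; have /andP[k0 lekn] := kn.
rewrite sym_char_hook // hook_char_coef ?card_ord ?cs //.
rewrite (prod_single_cycle (fun l => 1 - (- 'X) ^+ l)) // cs mulrBr mulr1 coefB.
rewrite -{1}(@coef_Xn_add1X n k 0 l.+1 (n - l).-1) //; last by lia.
rewrite -addn1 -(@coef_Xn_add1X n k l 1 (n - l).-1) //; last by lia.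
rewrite expr0 mul1r; congr (_ - _).
rewrite (exprNn 'X) -[in RHS]coefCM; congr ((polyseq _)`_ _).
by rewrite polyC_exp polyCN polyC1 mulrC mulrA.
Qed.

Lemma sym_char_two_cycles n k (s : 'S_n) (l : nat) : (1 <= k <= n)%N ->
  #|cycles_of s| = 2%N -> #|supp s| = l.+2 -> (l <= 3)%N -> (l.+2 < n)%N ->
  sym_char n (hook n k) s =
  binom (n%:Z - l.+3%:Z) (k%:Z - l.+3%:Z)
  - binom (n%:Z - l.+3%:Z) (k%:Z - l.+1%:Z)
  - (-1) ^+ l * (binom (n%:Z - l.+3%:Z) (k%:Z - 3%:Z)
  - binom (n%:Z - l.+3%:Z) (k%:Z - 1%:Z)).
Proof.
move=> kn c2 cs lel ltln; have /andP[k0 lekn] := kn.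
rewrite sym_char_hook // hook_char_coef ?card_ord ?cs //.
rewrite (prod_two_cycles (fun l => 1 - (- 'X) ^+ l)) ?cs // subn2 /=.
pose m := (n - l.+2).-1.
have val a b : (a + b = l.+3)%N ->
    binom (n%:Z - l.+3%:Z) (k%:Z - b%:Z) = ('X^a * (1 + 'X) ^+ m : {poly
      algC})`_(n - k).
  by move=> E; rewrite -E (@coef_Xn_add1X n k a b m) //; lia.
rewrite (val 0%N) // (val 2%N) // (val l 3) ?addn3 // (val l.+2 1%N) ?addn1 //.
rewrite -!coefB -coefCM -coefB; congr ((polyseq _)`_ _).
rewrite polyC_exp polyCN polyC1 -/m (exprNn 'X l) !(exprS 'X l.+1, exprS 'X l).
move: ('X^l) ((-1) ^+ l) ((1 + 'X) ^+ m) => u v w.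
ring.
Qed.

(** * The coefficients of the immanant *)

Definition along_edges (n : nat) (e : rel 'I_n) (s : 'S_n) : bool :=
  [forall i in supp s, e i (s i)].

Lemma char_poly_mx_laplacian n (e : rel 'I_n) i j : irreflexive e ->
  char_poly_mx (laplacian e) i j =
  if i == j then 'X - (deg e i)%:R%:P else (e i j)%:R%:P.
Proof.
move=> e_irr; rewrite /char_poly_mx /laplacian !mxE.
case: eqVneq => [->|_]; first by rewrite e_irr mulr1n subr0.
by rewrite mulr0n sub0r mulr0n sub0r rmorphN opprK.
Qed.

Lemma prod_char_poly_mx_laplacian n (e : rel 'I_n) (s : 'S_n) : irreflexive e ->
  \prod_i char_poly_mx (laplacian e) i (s i) =
  (along_edges e s)%:R * \prod_(i in ~: supp s) ('X - (deg e i)%:R%:P).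
Proof.
move=> e_irr; under eq_bigr => i _ do rewrite char_poly_mx_laplacian //.
rewrite (bigID (fun i => i \in supp s)) /=; congr (_ * _).
  rewrite (eq_bigr (fun i => (e i (s i))%:R)) => [|i]; last first.
    by rewrite inE eq_sym => /negPf->; rewrite polyC_natr.
  case: (boolP (along_edges e s)) => [/forall_inP H|].
    by rewrite big1 // => i /H->.
  by move=> /forall_inPn[i si ei]; rewrite (bigD1 i) //= (negPf ei) mul0r.
apply: eq_big => [i|i]; first by rewrite in_setC.
by rewrite inE negbK eq_sym => ->.
Qed.

(** A term of degree #|U| - j chooses -d(v) at the vertices of a j-set and X at the
    others. *)
Lemma coef_prod_degrees n (e : rel 'I_n) (U : {set 'I_n}) j : (j <= #|U|)%N ->
  (\prod_(i in U) ('X - (deg e i)%:R%:P) : {poly algC})`_(#|U| - j) =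
  (-1) ^+ j * (sym_deg e j U)%:R.
Proof.
move=> lej; pose F (i : 'I_n) : {poly algC} := (- (deg e i)%:R)%:P.
rewrite (eq_bigr (fun i => F i + 'X)) => [|i _]; last by rewrite /F polyCN addrC.
rewrite (prodD_subsets _ F (fun=> 'X)) coef_sum /sym_deg natr_sum mulr_sumr.
rewrite [RHS]big_mkcondr; apply: eq_bigr => J sJ.
rewrite prodr_const -rmorph_prod coefCM coefXn cardsDS //= eq_sym.
have leJ := subset_leq_card sJ.
have -> : (#|U| - #|J| == #|U| - j)%N = (#|J| == j)%N by rewrite eqn_sub2lE.
case: eqP => [cJ|]; rewrite ?mulr0 // mulr1 natr_prod -cJ -prodrN.
by [].
Qed.

Lemma coef_prod_degrees_small n (e : rel 'I_n) (U : {set 'I_n}) j : (#|U| < j)%N ->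
  (\prod_(i in U) ('X - (deg e i)%:R%:P) : {poly algC})`_j = 0.
Proof.
move=> lt; rewrite nth_default //.
by rewrite -big_enum size_prod_XsubC -cardE.
Qed.

(** The part of c_r due to the permutations that move exactly t points. *)
Definition supp_term n k (e : rel 'I_n) (t r : nat) : algC :=
  \sum_(s : 'S_n | along_edges e s && (#|supp s| == t))
     (-1) ^+ t * sym_char n (hook n k) s * (sym_deg e (r - t) (~: supp s))%:R.

(** The fixed points of s contribute a polynomial whose degree is their number
    n - t, so s has no term of degree n - r unless t <= r; the powers of -1 then
    combine as r + (r - t), which has the parity of t. *)
Lemma coef_immanant_laplacian n k (e : rel 'I_n) (c : nat -> algC) r :
  irreflexive e ->
  immanant (hook n k) (char_poly_mx (laplacian e)) =
    \sum_(r < n.+1) ((-1) ^+ r * c r) *: 'X^(n - r) ->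
  (r <= n)%N -> c r = \sum_(t < r.+1) supp_term k e t r.
Proof.
move=> e_irr hc ler.
have E : (immanant (hook n k) (char_poly_mx (laplacian e)))`_(n - r) = (-1) ^+
  r * c r.
  rewrite hc coef_sum (bigD1 (Ordinal (ler : r < n.+1)%N)) //= big1 ?addr0.
    by rewrite coefZ coefXn eqxx mulr1.
  move=> i; rewrite -val_eqE /= coefZ coefXn => ir.
  have -> : (n - r == n - i)%N = false by have := ltn_ord i; lia.
  by rewrite mulr0.
have -> : c r = (-1) ^+ r * ((-1) ^+ r * c r).
  by rewrite mulrA -exprD addnn -signr_odd odd_double mul1r.
rewrite -E /immanant coef_sum mulr_sumr /supp_term (bigID (fun s : 'S_n =>
  along_edges e s && (#|supp s| <= r)%N)) /=.
rewrite [X in _ + X]big1 ?addr0 => [|s]; last first.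
  rewrite negb_and coefZ prod_char_poly_mx_laplacian // => /orP[/negPf->|].
    by rewrite mul0r coef0 !mulr0.
  rewrite -ltnNge => ltr; rewrite -polyC_natr coefCM coef_prod_degrees_small
    ?mulr0 //.
  have := cardsC (supp s); rewrite card_ord; move: ltr ler.
  move: #|supp s| #|~: supp s| => x y. lia.
rewrite (partition_big (fun s : 'S_n => inord #|supp s| : 'I_r.+1) predT) //=.
apply: eq_bigr => t _; apply: eq_big => [s|s].
  have := ltn_ord t; rewrite ltnS => let_; case: (along_edges e s) => //=.
  apply/andP/eqP => [[le /eqP <-]|->]; first by rewrite inordK.
  by split=> //; apply/eqP/val_inj; rewrite /= inordK.
move=> /andP[/andP[as_ les] /eqP Et].
have {}Et : #|supp s| = t by rewrite -Et inordK.
have cC := cardsC (supp s); rewrite card_ord Et in cC.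
have letr : (t <= r)%N by rewrite -ltnS.
rewrite coefZ prod_char_poly_mx_laplacian // as_ mul1r.
have -> : (n - r = #|~: supp s| - (r - t))%N by lia.
rewrite coef_prod_degrees; last by lia.
rewrite !mulrA; congr (_ * _); rewrite mulrAC -exprD; congr (_ * _).
have -> : (r + (r - t) = t + (r - t).*2)%N by lia.
by rewrite exprD -[X in _ * X = _]signr_odd odd_double mulr1.
Qed.

(** * Permutations moving along edges, and matchings *)

(** As a set of unordered pairs this forgets in which direction s runs through
    each of its cycles. *)
Definition step_edges (T : finType) (s : {perm T}) : {set {set T}} :=
  [set [set x; s x] | x in supp s].

Lemma supp_perm (T : finType) (s : {perm T}) x : (s x \in supp s) = (x \in supp s).
Proof. by rewrite !inE (inj_eq perm_inj). Qed.

Lemma suppV (T : finType) (s : {perm T}) : supp s^-1 = supp s.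
Proof.
by apply/setP => x; rewrite !inE -(inj_eq (@perm_inj _ s)) permKV eq_sym.
Qed.

Lemma cover_step_edges (T : finType) (s : {perm T}) : cover (step_edges s) = supp s.
Proof.
apply/setP => x; apply/bigcupP/idP => [[_ /imsetP[y ys ->]]|xs].
  by rewrite in_set2 => /orP[]/eqP->; rewrite ?supp_perm.
by exists [set x; s x]; [apply: imset_f | rewrite !inE eqxx].
Qed.

Lemma mem_step_edges (T : finType) (s : {perm T}) x y :
  x != y -> ([set x; y] \in step_edges s) = (s x == y) || (s y == x).
Proof.
move=> xy; apply/imsetP/orP => [[z _ /setP E]|].
  have := E z; have := E (s z); have := E y; have := E x; rewrite !inE !eqxx ?orbT.
  move=> /esym/orP[/eqP xz|/eqP xz]; subst => /esym/orP[/eqP yz|/eqP yz]; subst;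
    rewrite ?eqxx in xy *; by [|left|right].
case=> /eqP E; [exists x | exists y]; rewrite ?inE ?E // 1?eq_sym //.
by rewrite setUC.
Qed.

(** An unordered pair containing x comes from a step of t out of x or into x. *)
Lemma step_edges_next_or_prev (T : finType) (s t : {perm T}) x :
  step_edges s = step_edges t -> x \in supp s -> s x = t x \/ s x = t^-1%g x.
Proof.
move=> E xs; have xs' : x != s x by rewrite eq_sym; move: xs; rewrite inE.
have : [set x; s x] \in step_edges t by rewrite -E; apply: imset_f.
rewrite mem_step_edges // => /orP[/eqP->|/eqP tE]; first by left.
by right; rewrite -{2}tE permK.
Qed.

Lemma step_edgesV (T : finType) (s : {perm T}) : step_edges s^-1 = step_edges s.
Proof.
apply/setP => O; apply/imsetP/imsetP => -[x]; rewrite ?suppV => xs ->.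
  exists (s^-1%g x); first by rewrite -supp_perm permKV.
  by rewrite permKV setUC.
by exists (s x); rewrite ?suppV ?supp_perm // permK setUC.
Qed.

Lemma along_edgesV n (e : rel 'I_n) (s : 'S_n) : symmetric e ->
  along_edges e s -> along_edges e s^-1.
Proof.
move=> e_sym /forall_inP H; apply/forall_inP => i; rewrite suppV => si.
by rewrite e_sym -{2}(permKV s i); apply: H; rewrite -supp_perm permKV.
Qed.

Lemma mem_edges n (e : rel 'I_n) x y : symmetric e ->
  ([set x; y] \in edges e) = e x y.
Proof.
move=> e_sym; apply/imsetP/idP => [[[u v] /= uv]|xy]; last by exists (x, y);
  rewrite ?inE.
move: uv; rewrite inE /= => uv /setP E.
have Ex : (x == u) || (x == v) by have := E x; rewrite !inE eqxx => <-.
have Ey : (y == u) || (y == v) by have := E y; rewrite !inE eqxx orbT => <-.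
have Eu : (u == x) || (u == y) by have := E u; rewrite !inE eqxx => ->.
have Ev : (v == x) || (v == y) by have := E v; rewrite !inE eqxx orbT => ->.
case/orP: Ex Eu Ev => /eqP->; case/orP: Ey => /eqP->; rewrite ?orbb // => Eu Ev.
- by rewrite -{2}(eqP Ev).
- by rewrite e_sym.
- by rewrite -{1}(eqP Eu).
Qed.

Lemma edgesP n (e : rel 'I_n) (E : {set 'I_n}) : symmetric e -> irreflexive e ->
  reflect (exists x y, [/\ E = [set x; y], e x y & x != y]) (E \in edges e).
Proof.
move=> e_sym e_irr; apply: (iffP idP) => [|[x [y [-> exy _]]]];
  last by rewrite mem_edges.
move=> /imsetP[[x y] /=]; rewrite inE /= => exy ->; exists x, y; split=> //.
by apply: contraTneq exy => ->; rewrite e_irr.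
Qed.

Lemma card_edge n (e : rel 'I_n) E : symmetric e -> irreflexive e ->
  E \in edges e -> #|E| = 2%N.
Proof.
by move=> e_sym e_irr /(edgesP _ e_sym e_irr)[x [y [-> _ xy]]]; rewrite cards2 xy.
Qed.

Lemma step_edges_edges n (e : rel 'I_n) s : symmetric e ->
  (step_edges s \subset edges e) = along_edges e s.
Proof.
move=> e_sym; apply/subsetP/forall_inP => [H i si|H _ /imsetP[i si ->]].
  by rewrite -mem_edges //; apply: H; apply: imset_f.
by rewrite mem_edges //; apply: H.
Qed.

(** The involution that exchanges the two ends of each edge of a matching. *)
Definition mate (T : finType) (M : {set {set T}}) (x : T) : T :=
  if x \in cover M then odflt x [pick y in pblock M x :\ x] else x.

Lemma mate_edge (T : finType) (M : {set {set T}}) x y :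
  trivIset M -> [set x; y] \in M -> y != x -> mate M x = y.
Proof.
move=> tM xyM yx; have xM : x \in cover M.
  by apply/bigcupP; exists [set x; y]; rewrite // !inE eqxx.
rewrite /mate xM (def_pblock tM xyM) ?inE ?eqxx //.
case: pickP => [z|/(_ y)]; rewrite !inE ?eqxx ?orbT ?yx //.
by case/andP => /negPf->; rewrite orFb => /eqP.
Qed.

Lemma mateP (T : finType) (M : {set {set T}}) x :
  trivIset M -> {in M, forall E : {set T}, #|E| = 2%N} -> x \in cover M ->
  [/\ mate M x != x, [set x; mate M x] \in M & mate M (mate M x) = x].
Proof.
move=> tM cM /bigcupP[E EM xE].
have /eqP/cards2P[u [v [uv Euv]]] := cM _ EM; rewrite Euv in EM xE.
have vuM : [set v; u] \in M by rewrite setUC.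
have mu : mate M u = v by apply: mate_edge => //; rewrite eq_sym.
have mv : mate M v = u by apply: mate_edge => //.
by case/set2P: xE => ->; rewrite ?mu ?mv ?mu //; split; rewrite // eq_sym.
Qed.

Lemma mateK (T : finType) (M : {set {set T}}) :
  trivIset M -> {in M, forall E : {set T}, #|E| = 2%N} -> involutive (mate M).
Proof.
move=> tM cM x; case: (boolP (x \in cover M)) => [/(mateP tM cM)[] //|xM].
by have mx : mate M x = x; [rewrite /mate (negPf xM) | rewrite !mx].
Qed.

Lemma permV_involution (T : finType) (s : {perm T}) : (s * s)%g = 1%g -> s^-1%g = s.
Proof. by move=> E; apply: (mulgI s); rewrite mulgV E. Qed.

Lemma step_edges_inj_involution (T : finType) (s t : {perm T}) :
  (s * s)%g = 1%g -> (t * t)%g = 1%g -> step_edges s = step_edges t -> s = t.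
Proof.
move=> s2 t2 E; have Es : supp s = supp t by rewrite -!cover_step_edges E.
apply/permP => x; case: (boolP (x \in supp s)) => xs.
  by have [] := step_edges_next_or_prev E xs; rewrite ?(permV_involution t2).
have := xs; rewrite Es; move: xs; rewrite !inE !negbK => /eqP-> /eqP->//.
Qed.

Lemma trivIset_step_edges_involution (T : finType) (s : {perm T}) :
  (s * s)%g = 1%g -> trivIset (step_edges s).
Proof.
move=> s2; have ss x : s (s x) = x by rewrite -permM s2 perm1.
apply/trivIsetP => _ _ /imsetP[x _ ->] /imsetP[y _ ->].
apply: contraR => /pred0Pn[z /andP[/= /set2P[]-> /set2P[]]] E.
- by rewrite E.
- by rewrite E ss setUC.
- by rewrite -E ss setUC.
- by rewrite (perm_inj E).
Qed.

(** An involution is determined by its 2-cycles, and these form a matching;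
    conversely [mate] turns a matching into an involution. *)
Lemma sum_involutions_matchings n (e : rel 'I_n) l (V : nmodType)
    (g : {set 'I_n} -> V) : symmetric e -> irreflexive e ->
  \sum_(s : 'S_n | [&& along_edges e s, #|supp s| == (2 * l)%N & (s * s ==
    1)%g]) g (supp s) =
  \sum_(M in matchings e l) g (cover M).
Proof.
move=> e_sym e_irr.
pose D := [set s : 'S_n | [&& along_edges e s, #|supp s| == (2 * l)%N & (s * s
  == 1)%g]].
have inj : {in D &, injective (@step_edges 'I_n)}.
  by move=> s t; rewrite !inE => /and3P[_ _ /eqP s2] /and3P[_ _ /eqP t2];
    apply: step_edges_inj_involution.
have card_triv (M : {set {set 'I_n}}) : M \subset edges e -> trivIset M ->
    #|cover M| = (#|M| * 2)%N.
  move=> /subsetP sM /eqP <-; rewrite -sum_nat_const; apply: eq_bigr => E /sM.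
  exact: card_edge.
have -> : matchings e l = (@step_edges 'I_n) @: D.
  apply/setP => M; rewrite inE; apply/and3P/imsetP => [[sM tM /eqP cM]|[s]].
    have c2 : {in M, forall E : {set 'I_n}, #|E| = 2%N}.
      by move=> E /(subsetP sM); apply: card_edge.
    pose s := perm (inv_inj (mateK tM c2)).
    have supps : supp s = cover M.
      apply/setP => x; rewrite inE permE; apply/idP/idP => [|/(mateP tM c2)[] //].
      by apply: contraR => xM; rewrite /mate (negPf xM).
    have Es : M = step_edges s.
      apply/setP => E; apply/idP/imsetP => [EM|[x]].
        have /eqP/cards2P[u [v [uv Euv]]] := c2 _ EM; exists u.
          by rewrite supps; apply/bigcupP; exists E; rewrite // Euv !inE eqxx.
        by rewrite permE (@mate_edge _ _ _ v) // -?Euv // eq_sym.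
      by rewrite supps permE => /(mateP tM c2)[_ + _] ->.
    exists s => //; rewrite inE -step_edges_edges // -Es sM supps card_triv //
      cM mulnC eqxx.
    by apply/eqP/permP => x; rewrite permM perm1 !permE mateK.
  rewrite inE => /and3P[as_ /eqP cs /eqP s2] ->.
  have sE : step_edges s \subset edges e by rewrite step_edges_edges.
  split; rewrite ?trivIset_step_edges_involution //.
  have := card_triv _ sE (trivIset_step_edges_involution s2).
  by rewrite cover_step_edges cs mulnC => /eqP; rewrite eqn_pmul2r // eq_sym.
rewrite big_imset //=; apply: eq_big => s; first by rewrite inE.
by rewrite cover_step_edges.
Qed.

(** * Cyclic permutations and cycles of the graph *)

Lemma one_cycle_porbit (T : finType) (s : {perm T}) x :
  #|cycles_of s| = 1%N -> x \in supp s -> porbit s x = supp s.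
Proof.
move=> c1 xs; apply/set1P; rewrite -cycles_of_single // inE card_porbit_gt1.
by move: xs; rewrite inE => ->; rewrite andbT; apply/imsetP; exists x.
Qed.

Lemma one_cycleP (T : finType) (s : {perm T}) x :
  x \in supp s -> porbit s x = supp s -> #|cycles_of s| = 1%N.
Proof.
move=> xs Ex; apply/eqP/cards1P; exists (supp s); apply/setP => O; rewrite inE.
apply/idP/eqP => [|->].
  rewrite inE => /andP[/imsetP[y _ ->]]; rewrite card_porbit_gt1 => ys.
  by rewrite -Ex; apply/eqP; rewrite eq_porbit_mem Ex inE.
by rewrite -Ex inE card_porbit_gt1; move: xs; rewrite inE => ->; rewrite andbT;
  apply/imsetP; exists x.
Qed.

Lemma porbit_period2 (T : finType) (s : {perm T}) x : s (s x) = x ->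
  (#|porbit s x| <= 2)%N.
Proof.
move=> ss; apply: leq_trans (_ : #|[set x; s x]| <= 2)%N;
  last by rewrite cards2; case: eqP.
apply: subset_leq_card; apply/subsetP => _ /porbitP[i ->].
elim: i => [|i]; first by rewrite expg0 perm1 !inE eqxx.
by rewrite expgSr permM !inE => /orP[]/eqP->; rewrite ?ss eqxx ?orbT.
Qed.

(** The agreement at x propagates along the cycle: if t turned back at some point,
    it would have an orbit of size 2. *)
Lemma step_edges_one_cycle_eq (T : finType) (s t : {perm T}) x :
  #|cycles_of s| = 1%N -> #|cycles_of t| = 1%N -> (2 < #|supp s|)%N ->
  step_edges s = step_edges t -> x \in supp s -> s x = t x -> s = t.
Proof.
move=> cs ct gt2 E xs stx; have Es : supp s = supp t by rewrite
  -!cover_step_edges E.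
have step y : y \in supp s -> s y = t y -> s (s y) = t (s y).
  move=> ys sty; have sys : s y \in supp s by rewrite supp_perm.
  have [//|ssy] := step_edges_next_or_prev E sys; move: ssy;
    rewrite sty permK -sty => ssy.
  have := porbit_period2 ssy; rewrite one_cycle_porbit // leqNgt gt2 //.
have all i : s ((s ^+ i)%g x) = t ((s ^+ i)%g x).
  elim: i => [|i IH]; first by rewrite expg0 perm1.
  rewrite expgSr permM; apply: step => //.
  by rewrite -(one_cycle_porbit cs xs); apply: mem_porbit.
apply/permP => y; case: (boolP (y \in supp s)) => ys.
  by move: ys; rewrite -(one_cycle_porbit cs xs) => /porbitP[i ->].
have := ys; rewrite Es; move: ys; rewrite !inE !negbK => /eqP-> /eqP->//.
Qed.

Lemma cycles_ofV (T : finType) (s : {perm T}) : cycles_of s^-1 = cycles_of s.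
Proof. by rewrite /cycles_of porbitsV. Qed.

(** At any point, t leaves either as s does or as its inverse does. *)
Lemma step_edges_one_cycle_fibre (T : finType) (s t : {perm T}) :
  #|cycles_of s| = 1%N -> #|cycles_of t| = 1%N -> (2 < #|supp s|)%N ->
  step_edges s = step_edges t -> s = t \/ s = t^-1%g.
Proof.
move=> cs ct gt2 E; have /set0Pn[x xs] : supp s != set0 by rewrite -card_gt0
  (ltn_trans _ gt2).
have [st|st] := step_edges_next_or_prev E xs; first by left;
  apply: step_edges_one_cycle_eq st.
by right; apply: step_edges_one_cycle_eq st; rewrite ?cycles_ofV ?step_edgesV.
Qed.


Lemma ucycle_one_cycle n (e : rel 'I_n) (t : seq 'I_n) :
  irreflexive e -> path.cycle e t -> uniq t -> (0 < size t)%N ->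
  exists s : 'S_n, [/\ along_edges e s, supp s =i t, #|cycles_of s| = 1%N &
    forall x, s x = next t x].
Proof.
move=> e_irr ct Ut t0; have inj : injective (next t) := can_inj (prev_next Ut).
pose s := perm inj; have sE x : s x = next t x by rewrite permE.
have supps : supp s =i t.
  move=> x; rewrite inE sE; apply/idP/idP => [|xt].
    by apply: contraR => xt; rewrite next_nth (negPf xt).
  by have := next_cycle ct xt; apply: contraTneq => ->; rewrite e_irr.
exists s; split=> //.
  apply/forall_inP => x; rewrite supps sE; apply: next_cycle ct.
have [x xt] : exists x, x \in t.
  by case: t t0 {ct Ut inj s sE supps} => // x t _; exists x; rewrite inE eqxx.
apply: (@one_cycleP _ _ x); first by rewrite supps.
have fc : fcycle s t by apply: cycle_from_next => // y yt; rewrite /= sE.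
apply/setP => y; rewrite supps -(fconnect_cycle fc xt).
apply/porbitP/idP => [[i ->]|/iter_findex <-]; first by rewrite permX fconnect_iter.
by exists (findex s x y); rewrite permX.
Qed.

Lemma one_cycle_ucycle n (e : rel 'I_n) (s : 'S_n) :
  along_edges e s -> #|cycles_of s| = 1%N -> (0 < #|supp s|)%N ->
  exists t : seq 'I_n, [/\ size t = #|supp s|, path.cycle e t, uniq t, supp s =i t &
    {in t, forall x, s x = next t x}].
Proof.
move=> as_ cs; rewrite card_gt0 => /set0Pn[x xs].
have Ex := one_cycle_porbit cs xs; pose t := traject s x #|porbit s x|.
have tE : supp s =i t by move=> y; rewrite -Ex porbit_traject.
have Ut : uniq t by apply: uniq_traject_porbit.
have fc : fcycle s t.
  rewrite /t; have := iter_porbit s x; case: #|_| => // m it.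
  have E : rcons (traject s (s x) m) x = traject s (s x) m.+1.
    by rewrite trajectSr -iterSr it.
  by rewrite /= E fpath_traject.
have nx : {in t, forall y, s y = next t y} by move=> y yt;
  apply/eqP/(next_cycle fc).
exists t; split=> //; first by rewrite size_traject Ex.
apply: cycle_from_next => // y yt; rewrite -nx //; move/forall_inP: as_; apply.
by rewrite tE.
Qed.

Lemma step_edges_next (T : finType) (s : {perm T}) (t : seq T) :
  supp s =i t -> {in t, forall x, s x = next t x} ->
  [set [set x; next t x] | x in t] = step_edges s.
Proof.
move=> st tn; apply/setP => E; apply/imsetP/imsetP => -[x xt ->].
  by exists x; rewrite ?st ?tn.
by exists x; rewrite -?st ?tn -?st.
Qed.

Lemma cycles_step_edges n (e : rel 'I_n) l : symmetric e -> irreflexive e ->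
  (2 < l)%N ->
  cycles e l = (@step_edges 'I_n) @:
    [set s : 'S_n | [&& along_edges e s, #|supp s| == l & #|cycles_of s| == 1%N]].
Proof.
move=> e_sym e_irr l2; set D := [set s | _].
apply/setP => C; apply/imsetP/imsetP => [[t]|[s]].
  rewrite inE l2 /= => /andP[ct Ut] ->.
  have [|s [as_ ts cs sE]] := ucycle_one_cycle e_irr ct Ut;
    first by rewrite size_tuple (ltn_trans _ l2).
  exists s; first by rewrite inE as_ cs (eq_card ts) (card_uniqP Ut) size_tuple
    !eqxx.
  by apply: step_edges_next => // x _.
rewrite inE => /and3P[as_ /eqP cl /eqP cs] ->.
have [|t [st ct Ut ts tn]] := one_cycle_ucycle as_ cs;
  first by rewrite cl (ltn_trans _ l2).
have szt : size t == l by rewrite st cl.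
exists (Tuple szt); first by rewrite inE l2 /= /ucycleb ct.
by rewrite -(step_edges_next ts tn).
Qed.

(** A cycle of the graph carries two cyclic permutations, one for each
    orientation, and they differ because its length is at least 3. *)
Lemma sum_one_cycles n (e : rel 'I_n) l (V : nmodType)
    (g : {set 'I_n} -> V) : symmetric e -> irreflexive e -> (2 < l)%N ->
  \sum_(s : 'S_n | [&& along_edges e s, #|supp s| == l & #|cycles_of s| ==
    1%N]) g (supp s) =
  (\sum_(C in cycles e l) g (cover C)) *+ 2.
Proof.
move=> e_sym e_irr l2.
pose D := [set s : 'S_n | [&& along_edges e s, #|supp s| == l & #|cycles_of s|
  == 1%N]].
have cycE : cycles e l = (@step_edges 'I_n) @: D by apply: cycles_step_edges.
rewrite cycE (eq_bigl (fun s => s \in D)) => [|s]; last by rewrite inE.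
rewrite (partition_big_imset (@step_edges 'I_n)) /= -sumrMnl;
  apply: eq_bigr => C /imsetP[s0].
rewrite inE => /and3P[as_ /eqP cl /eqP cs] ->.
rewrite (eq_bigr (fun=> g (cover (step_edges s0)))) => [|s /andP[_ /eqP <-]];
  last by rewrite cover_step_edges.
rewrite sumr_const; congr (_ *+ _).
rewrite (eq_card (_ : _ =i [set s0; s0^-1%g])) => [|s].
  rewrite cards2; case: eqVneq => // E.
  have /set0Pn[x xs] : supp s0 != set0 by rewrite -card_gt0 cl (ltn_trans _ l2).
  have : s0 (s0 x) = x by rewrite {2}E permKV.
  by move/porbit_period2; rewrite one_cycle_porbit // cl leqNgt l2.
rewrite !inE unfold_in /= inE; apply/andP/orP =>
  [[/and3P[_ /eqP cl' /eqP cs'] /eqP E]|].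
  have [|->|->] := step_edges_one_cycle_fibre cs' cs _ E; rewrite ?cl' ?eqxx;
    by [|left|right].
case=> /eqP->; rewrite ?step_edgesV ?cycles_ofV ?suppV ?along_edgesV ?as_ ?cl
  ?cs ?eqxx //.
Qed.

(** * Permutations of cycle type (3,2) *)

Lemma mem_cycles_of_period (T : finType) (s : {perm T}) O x :
  O \in cycles_of s -> x \in O -> (s ^+ #|O|)%g x = x.
Proof.
rewrite inE => /andP[/imsetP[y _ ->] _]; rewrite -eq_porbit_mem => /eqP <-.
by rewrite permX iter_porbit.
Qed.

Lemma out_supp_expg (T : finType) (s : {perm T}) i x :
  x \notin supp s -> (s ^+ i)%g x = x.
Proof.
rewrite inE negbK => /eqP sx; elim: i => [|i IH]; first by rewrite expg0 perm1.
by rewrite expgSr permM IH.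
Qed.

Lemma one_cycle_expg (T : finType) (s : {perm T}) :
  #|cycles_of s| = 1%N -> (s ^+ #|supp s|)%g = 1%g.
Proof.
move=> c1; apply/permP => x; rewrite perm1; case: (boolP (x \in supp s)) => xs.
  by rewrite (@mem_cycles_of_period _ _ (supp s)) // cycles_of_single ?inE.
exact: out_supp_expg.
Qed.

Lemma small_supp_one_cycle (T : finType) (s : {perm T}) :
  (0 < #|supp s| < 4)%N -> #|cycles_of s| = 1%N.
Proof.
by move=> lt; have := cycles_of_card_ge2 s; have := cycles_of_eq0 s; lia.
Qed.

Lemma mul_disjoint_supp (T : finType) (s t : {perm T}) x :
  [disjoint supp s & supp t] -> (s * t)%g x = if x \in supp s then s x else t x.
Proof.
move=> dst; rewrite permM; case: ifPn => [xs|]; last by rewrite inE negbK => /eqP->.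
have : s x \notin supp t by rewrite (disjointFr dst) // supp_perm.
by rewrite inE negbK => /eqP.
Qed.

Lemma commute_disjoint_supp (T : finType) (s t : {perm T}) :
  [disjoint supp s & supp t] -> commute s t.
Proof.
move=> dst; apply/permP => x; rewrite !mul_disjoint_supp // 1?disjoint_sym //.
case: ifPn => xs; first by rewrite (disjointFr dst).
by case: ifPn => //; move: xs; rewrite !inE !negbK => /eqP-> /eqP.
Qed.

Lemma supp_mul_disjoint (T : finType) (s t : {perm T}) :
  [disjoint supp s & supp t] -> supp (s * t)%g = supp s :|: supp t.
Proof.
move=> dst; apply/setP => x; rewrite in_setU [LHS]inE mul_disjoint_supp //.
by case: ifPn => [|_]; rewrite inE // => ->.
Qed.

(** The exponents 4 and 3 are the residues modulo 6 that are 1 modulo 3 and 0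
    modulo 2, respectively the other way round, so these powers isolate the
    3-cycle and the transposition. *)
Lemma mul32_expg (T : finType) (s t : {perm T}) :
  #|supp s| = 3%N -> #|supp t| = 2%N -> [disjoint supp s & supp t] ->
  [/\ ((s * t) ^+ 4 = s)%g, ((s * t) ^+ 3 = t)%g & ((s * t) ^+ 6 = 1)%g].
Proof.
move=> cs ct dst; have cst := commute_disjoint_supp dst.
have s3 : (s ^+ 3 = 1)%g by rewrite -cs one_cycle_expg // small_supp_one_cycle
  // cs.
have t2 : (t ^+ 2 = 1)%g by rewrite -ct one_cycle_expg // small_supp_one_cycle
  // ct.
rewrite !expgMn //; split.
- by rewrite (expgSr s 3) s3 mul1g (expgM t 2 2) t2 expg1n mulg1.
- by rewrite s3 mul1g expgSr t2 mul1g.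
by rewrite (expgM s 3 2) s3 (expgM t 2 3) t2 !expg1n mulg1.
Qed.

Lemma split32 (T : finType) (s : {perm T}) : #|supp s| = 5%N ->
  #|cycles_of s| = 2%N ->
  [/\ #|supp (s ^+ 4)%g| = 3%N, #|supp (s ^+ 3)%g| = 2%N,
      [disjoint supp (s ^+ 4)%g & supp (s ^+ 3)%g] , (s ^+ 4 * s ^+ 3 = s)%g
    & (forall x, x \in supp (s ^+ 4)%g -> x \in supp s /\ (s ^+ 4)%g x = s x) /\
      (forall x, x \in supp (s ^+ 3)%g -> x \in supp s /\ (s ^+ 3)%g x = s x)].
Proof.
move=> c5 c2.
have [O3 [O2 [E c3 cc2 dO]]] : exists O3 O2 : {set T}, [/\ cycles_of s = [set
  O3; O2],
    #|O3| = 3%N, #|O2| = 2%N & [disjoint O3 & O2]].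
  have /eqP/cards2P[A [B [AB E]]] := c2.
  have dAB : [disjoint A & B].
    by apply: (trivIsetP (trivIset_cycles_of s)); rewrite // E !inE eqxx ?orbT.
  have := sum_card_cycles_of s; rewrite c5 E big_setU1 ?inE // big_set1 /= => sAB.
  have : (A \in cycles_of s) && (B \in cycles_of s) by rewrite E !inE !eqxx orbT.
  rewrite !inE => /andP[/andP[_ cA] /andP[_ cB]].
  have [h|h] : ((#|A| = 3%N /\ #|B| = 2%N) \/ (#|A| = 2%N /\ #|B| = 3%N))%N by lia.
    by exists A, B; case: h.
  by exists B, A; case: h => h1 h2; rewrite disjoint_sym setUC.
have O3s : O3 \in cycles_of s by rewrite E !inE eqxx.
have O2s : O2 \in cycles_of s by rewrite E !inE eqxx orbT.
have supps : supp s = O3 :|: O2.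
  by rewrite -cover_cycles_of E /cover bigcup_setU !big_set1.
have p3 x : x \in O3 -> (s ^+ 3)%g x = x by move=> /(mem_cycles_of_period O3s);
  rewrite c3.
have p2 x : x \in O2 -> (s ^+ 2)%g x = x by move=> /(mem_cycles_of_period O2s);
  rewrite cc2.
have p4 x : x \in O3 -> (s ^+ 4)%g x = s x by move=> xO; rewrite expgSr permM p3.
have p23 x : x \in O2 -> (s ^+ 3)%g x = s x by move=> xO; rewrite expgSr permM p2.
have p24 x : x \in O2 -> (s ^+ 4)%g x = x by move=> xO;
  rewrite (expgM s 2 2) expgSr permM !p2.
have E4 : supp (s ^+ 4)%g = O3.
  apply/setP => x; rewrite inE; case: (boolP (x \in supp s)) => xs; last first.
    by rewrite out_supp_expg // eqxx; move: xs;
      rewrite supps inE negb_or => /andP[/negPf->].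
  move: (xs); rewrite {1}supps inE => /orP[xO|xO].
    by rewrite p4 // xO; move: xs; rewrite inE.
  by rewrite p24 // eqxx (disjointFl dO).
have E3 : supp (s ^+ 3)%g = O2.
  apply/setP => x; rewrite inE; case: (boolP (x \in supp s)) => xs; last first.
    by rewrite out_supp_expg // eqxx; move: xs;
      rewrite supps inE negb_or => /andP[_ /negPf->].
  move: (xs); rewrite {1}supps inE => /orP[xO|xO].
    by rewrite p3 // eqxx (disjointFr dO).
  by rewrite p23 // xO; move: xs; rewrite inE.
rewrite E4 E3; split=> //.
  apply/permP => x; rewrite mul_disjoint_supp ?E4 ?E3 //; case: ifPn => xO;
    first exact: p4.
  case: (boolP (x \in supp s)) => xs; last first.
    by rewrite out_supp_expg //; move: xs; rewrite inE negbK => /eqP.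
  by move: xs; rewrite supps inE (negPf xO) => /p23.
by split=> x xO; rewrite supps inE xO ?orbT ?p4 ?p23.
Qed.

Lemma matchings1 n (e : rel 'I_n) : symmetric e -> irreflexive e ->
  matchings e 1 = set1 @: edges e.
Proof.
move=> e_sym e_irr; apply/setP => M; rewrite inE;
  apply/and3P/imsetP => [[sM _ /cards1P[E EM]]|].
  by exists E => //; move: sM; rewrite EM sub1set.
move=> [E EE ->]; rewrite sub1set EE cards1; split=> //.
by apply/trivIsetP => A B /set1P-> /set1P->; rewrite eqxx.
Qed.

Lemma big_matchings1 n (e : rel 'I_n) (V : nmodType) (g : {set 'I_n} -> V) :
  symmetric e -> irreflexive e ->
  \sum_(M in matchings e 1) g (cover M) = \sum_(E in edges e) g E.
Proof.
move=> e_sym e_irr; rewrite matchings1 // big_imset /=; last exact: in2W set1_inj.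
by apply: eq_bigr => E _; rewrite cover1.
Qed.

Lemma sum_transpositions n (e : rel 'I_n) (V : nmodType)
    (g : {set 'I_n} -> V) : symmetric e -> irreflexive e ->
  \sum_(s : 'S_n | along_edges e s && (#|supp s| == 2%N)) g (supp s) =
  \sum_(M in matchings e 1) g (cover M).
Proof.
move=> e_sym e_irr; rewrite -sum_involutions_matchings //.
apply: eq_bigl => s; rewrite muln1; case: eqVneq => cs; rewrite ?andbF //.
have := @one_cycle_expg _ s; rewrite small_supp_one_cycle ?cs // => /(_ erefl).
by rewrite expgS expg1 => ->; rewrite eqxx.
Qed.

(** The pair of powers of [split32] and the product are mutually inverse maps
    between these permutations and the pairs formed by a 3-cycle and a
    transposition with disjoint supports. *)
Lemma card_type32 n (e : rel 'I_n) : symmetric e -> irreflexive e ->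
  #|[set s : 'S_n | [&& along_edges e s, #|supp s| == 5%N & #|cycles_of s| ==
    2%N]]| =
  (2 * \sum_(C in cycles e 3) #|[set E in edges e | [disjoint cover C & E]]|)%N.
Proof.
move=> e_sym e_irr; transitivity
  ((\sum_(C in cycles e 3) #|[set E in edges e | [disjoint cover C & E]]|) *+
    2); last first.
  by rewrite mulr2n mul2n -addnn.
set D := [set s : 'S_n | _].
pose P := [set p : 'S_n * 'S_n | [&& along_edges e p.1, #|supp p.1| == 3%N,
  along_edges e p.2,
   #|supp p.2| == 2%N & [disjoint supp p.1 & supp p.2]]].
have DE : D = (fun p : 'S_n * 'S_n => p.1 * p.2)%g @: P.
  apply/setP => s; apply/idP/imsetP => [|[[t u]]].
    rewrite inE => /and3P[/forall_inP as_ /eqP c5 /eqP c2].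
    have [c3 cc2 dst E [H4 H3]] := split32 c5 c2.
    exists (s ^+ 4, s ^+ 3)%g => //; rewrite inE /= c3 cc2 dst !eqxx !andbT /=.
    apply/andP; split; apply/forall_inP => x.
      by move=> /H4[xs ->]; apply: as_.
    by move=> /H3[xs ->]; apply: as_.
  rewrite inE /= => /and5P[/forall_inP at_ /eqP c3 /forall_inP au /eqP c2 dtu] ->.
  rewrite inE; have Es := supp_mul_disjoint dtu.
  have c5 : #|supp (t * u)%g| = 5%N.
    by rewrite Es cardsU (disjoint_setI0 dtu) cards0 c3 c2.
  rewrite c5 eqxx; apply/and3P; split=> //.
    apply/forall_inP => x; rewrite Es mul_disjoint_supp // inE.
    by case: ifPn => [xt _|_ /= xu]; [apply: at_ | apply: au].
  have [_ _ e6] := mul32_expg c3 c2 dtu.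
  (* A 5-cycle has order 5, whereas the order of t * u divides 6. *)
  have c1 : #|cycles_of (t * u)%g| != 1%N.
    apply/eqP => /one_cycle_expg; rewrite c5 => e5.
    move: e6; rewrite expgSr e5 mul1g => e1.
    by move: c5; rewrite e1 (_ : supp 1 = set0) ?cards0 //; apply/setP => x;
      rewrite !inE perm1 eqxx.
  move: c1 (cycles_of_card_ge2 (t * u)%g) (cycles_of_eq0 (t * u)%g); rewrite c5.
  by move: #|cycles_of _| => [|[|[|m]]].
rewrite DE card_in_imset; last first.
  move=> [t u] [t' u']; rewrite !inE /= =>
    /and5P[_ /eqP c3 _ /eqP c2 d] /and5P[_ /eqP c3' _ /eqP c2' d'] E.
  have [h4 h3 _] := mul32_expg c3 c2 d; have [h4' h3' _] := mul32_expg c3' c2' d'.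
  by congr (_, _); [rewrite -h4 E h4' | rewrite -h3 E h3'].
rewrite -sum1_card -(@sum_one_cycles _ _ _ _ (fun U =>
  #|[set E in edges e | [disjoint U & E]]|)) //.
rewrite (eq_bigl (fun p : 'S_n * 'S_n =>
  (along_edges e p.1 && (#|supp p.1| == 3%N)) &&
   ((along_edges e p.2 && (#|supp p.2| == 2%N)) && [disjoint supp p.1 & supp
     p.2]))); last first.
  by move=> p; rewrite inE !andbA.
rewrite -(pair_big_dep (fun t => along_edges e t && (#|supp t| == 3%N))
   (fun t u => (along_edges e u && (#|supp u| == 2%N)) && [disjoint supp t &
     supp u]) (fun _ _ => 1%N)) /=.
apply: eq_big => [t|t _].
  case: eqVneq => c3; rewrite ?andbF // andbT.
  by rewrite small_supp_one_cycle ?c3 ?andbT.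
rewrite big_mkcondr /= (@sum_transpositions _ _ _ (fun U =>
  if [disjoint supp t & U] then 1%N else 0%N)) //.
rewrite (@big_matchings1 _ _ _ (fun U =>
  if [disjoint supp t & U] then 1%N else 0%N)) //.
by rewrite -big_mkcondr -sum1_card; apply: eq_bigl => E; rewrite inE.
Qed.

(** * Counting incidences of vertices and edges *)

Lemma sym_deg0 n (e : rel 'I_n) S : sym_deg e 0 S = 1%N.
Proof.
rewrite /sym_deg (big_pred1 set0) => [|A]; first by rewrite big_set0.
by rewrite /= cards_eq0 andbC; case: eqVneq => // ->; rewrite sub0set.
Qed.

Lemma deg_edges n (e : rel 'I_n) v : symmetric e -> irreflexive e ->
  deg e v = #|[set E in edges e | v \in E]|.
Proof.
move=> e_sym e_irr; pose f (j : 'I_n) := [set v; j].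
have f_inj : {in [set j | e v j] &, injective f}.
  move=> i j; rewrite !inE => vi vj /setP/(_ i); rewrite !inE eqxx orbT.
  by case: eqVneq vi => [->|_ _ /esym/eqP]; rewrite ?e_irr.
rewrite /deg -(card_in_imset f_inj); apply: eq_card => E.
rewrite inE; apply/imsetP/andP => [[j]|[/(edgesP _ e_sym e_irr)[x [y [-> xy _]]]]].
  by rewrite inE => vj ->; rewrite mem_edges // !inE eqxx.
case/set2P => vE; first by exists y; rewrite ?inE /f vE.
by exists x; rewrite ?inE /f vE 1?e_sym // setUC.
Qed.

Lemma sum_deg_edges n (e : rel 'I_n) (U : {set 'I_n}) : symmetric e ->
  irreflexive e ->
  (\sum_(v in U) deg e v = \sum_(E in edges e) #|E :&: U|)%N.
Proof.
move=> e_sym e_irr.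
under eq_bigr => v _ do rewrite deg_edges // -sum1_card.
rewrite (exchange_big_dep (fun E => E \in edges e)) => [|v E _] /=;
  last by rewrite ?inE => /andP[].
apply: eq_bigr => E EE; rewrite -sum1_card; apply: eq_bigl => v.
by rewrite !inE EE andbC.
Qed.

Lemma handshake n (e : rel 'I_n) : symmetric e -> irreflexive e ->
  sym_deg e 1 [set: 'I_n] = (2 * #|edges e|)%N.
Proof.
move=> e_sym e_irr.
have -> : sym_deg e 1 [set: 'I_n] = (\sum_(v in [set: 'I_n]) deg e v)%N.
  rewrite /sym_deg (eq_bigl (mem (set1 @: [set: 'I_n]))) => [|A].
    rewrite big_imset /=; last exact: in2W set1_inj.
    by apply: eq_bigr => v _; rewrite big_set1.
  rewrite subsetT /=; apply/cards1P/imsetP => [[x ->]|[x _ ->]]; by exists x;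
    rewrite ?inE.
rewrite sum_deg_edges // mulnC -sum_nat_const; apply: eq_bigr => E EE.
by rewrite setIT (card_edge e_sym e_irr).
Qed.

(** The degree sum counts the edges meeting the triangle, each once, except that
    its three edges are counted twice. *)
Lemma card_edges_off_triangle n (e : rel 'I_n) C : symmetric e -> irreflexive e ->
  C \in cycles e 3 ->
  (#|[set E in edges e | [disjoint cover C & E]]| + deg_sum e C = #|edges e| + 3)%N.
Proof.
move=> e_sym e_irr; rewrite cycles_step_edges // => /imsetP[s].
rewrite inE => /and3P[/forall_inP as_ /eqP c3 /eqP c1] ->.
rewrite /deg_sum cover_step_edges sum_deg_edges //; set U := supp s.
have adj x y : x \in U -> y \in U -> x != y -> e x y.
  move=> xU yU xy; have Ex := one_cycle_porbit c1 xU.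
  have sU z : z \in U -> s z \in U by rewrite supp_perm.
  have := yU; rewrite /U -Ex porbit_traject Ex c3 !inE => /or3P[]/eqP Ey.
  - by rewrite Ey eqxx in xy.
  - by rewrite Ey; apply: as_.
  have s3 : s y = x.
    by rewrite Ey; have := iter_porbit s x; rewrite Ex c3.
  by rewrite e_sym -s3; apply: as_.
have split_card E : E \in edges e ->
    (#|E :&: U| = ~~ [disjoint U & E] + (E \subset U))%N.
  move=> EE; have cE := card_edge e_sym e_irr EE.
  rewrite -setI_eq0 (setIC U) -cards_eq0.
  have := subset_leq_card (subsetIl E U); rewrite cE.
  have -> : (E \subset U) = (#|E :&: U| == 2)%N.
    by rewrite -cE; apply/setIidPl/eqP => [->//|cEU]; apply/eqP;
      rewrite eqEcard subsetIl cEU leqnn.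
  by case: #|_| => [|[|[|m]]].
rewrite (eq_bigr _ split_card) big_split /= addnA.
have -> : (\sum_(E in edges e) (E \subset U) = 3)%N.
  rewrite -big_mkcondr sum1dep_card -[RHS]/('C(3, 2)) -c3 -cards_draws.
  apply: eq_card => E; rewrite !inE;
    apply/andP/andP => [[EE ->]|[EU /cards2P[x [y [xy Exy]]]]].
    by rewrite (card_edge e_sym e_irr).
  split=> //; rewrite Exy mem_edges //; apply: adj => //;
    by apply: (subsetP EU); rewrite Exy !inE eqxx ?orbT.
congr (_ + 3)%N; rewrite -[in RHS]sum1_card [in RHS](bigID (fun E : {set 'I_n}
  => [disjoint U & E])) /=.
by rewrite -sum1_card; congr (_ + _)%N; [apply: eq_bigl => E;
  rewrite inE | rewrite [RHS]big_mkcondr].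
Qed.

(** Two distinct edges that are not disjoint share exactly one vertex, so the pairs
    that fail to be matchings are counted by the pairs of edges at each vertex. *)
Lemma card_matchings2 n (e : rel 'I_n) : symmetric e -> irreflexive e ->
  (#|matchings e 2| + \sum_i 'C(deg e i, 2) = 'C(#|edges e|, 2))%N.
Proof.
move=> e_sym e_irr; rewrite -cards_draws.
have -> : (\sum_i 'C(deg e i, 2) =
   \sum_(A : {set {set 'I_n}} | (A \subset edges e) && (#|A| == 2)) ~~ trivIset
     A)%N.
  transitivity (\sum_i \sum_(A : {set {set 'I_n}} | (A \subset edges e) &&
    (#|A| == 2))
      [forall E in A, i \in E])%N.
    apply: eq_bigr => i _; rewrite deg_edges // -cards_draws -sum1_card
      -big_mkcondr.
    apply: eq_bigl => A; rewrite !inE andbAC; congr (_ && _).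
    apply/subsetP/andP => [H|[/subsetP sA /forall_inP iA] E EA].
      split; [apply/subsetP | apply/forall_inP] => E /H; rewrite inE => /andP[] //.
    by rewrite inE sA // iA.
  rewrite exchange_big; apply: eq_bigr => A /andP[sA /cards2P[E [F [EF EA]]]] /=.
  have [EE FE] : E \in edges e /\ F \in edges e.
    by split; apply: (subsetP sA); rewrite EA !inE eqxx ?orbT.
  transitivity #|E :&: F|.
    rewrite -sum1_card [RHS]big_mkcond /=; apply: eq_bigr => i _; rewrite EA inE.
    have -> : [forall E0 in [set E; F], i \in E0] = (i \in E) && (i \in F).
      apply/forall_inP/andP => [H|[iE iF] E0 /set2P[]->//].
      by split; apply: H; rewrite !inE eqxx ?orbT.
    by case: (_ && _).
  have -> : trivIset A = (#|E :&: F| == 0)%N.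
    rewrite cards_eq0 setI_eq0; apply/trivIsetP/idP => [H|dEF B D].
      by apply: H => //; rewrite EA !inE eqxx ?orbT.
    by rewrite EA => /set2P[]-> /set2P[]->; rewrite ?eqxx // disjoint_sym.
  have : (#|E :&: F| < 2)%N.
    rewrite ltnNge; apply: contra EF => le2.
    have cE := card_edge e_sym e_irr EE; have cF := card_edge e_sym e_irr FE.
    have /eqP hE : E :&: F == E by rewrite eqEcard subsetIl cE.
    have /eqP hF : E :&: F == F by rewrite eqEcard subsetIr cF.
    by rewrite -{1}hE hF.
  by case: #|_| => [|[|m]].
rewrite -[RHS]sum1_card -sum1_card [RHS](bigID (@trivIset 'I_n)) /=;
  congr (_ + _)%N.
  by apply: eq_bigl => A; rewrite !inE [LHS]andbA [LHS]andbAC.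
rewrite [RHS]big_mkcondr; apply: eq_big => [A|A _]; first by rewrite inE.
by case: trivIset.
Qed.

(** * The contributions of each size of support *)

Lemma supp_term0 n k (e : rel 'I_n) r : (1 <= k <= n)%N ->
  supp_term k e 0 r = (sym_deg e r [set: 'I_n])%:R * binom (n%:Z - 1) (k%:Z - 1).
Proof.
move=> kn; have /andP[k0 lekn] := kn; rewrite /supp_term (big_pred1 1%g) => [|s].
  have s0 : supp (1%g : 'S_n) = set0 by apply/setP => x; rewrite !inE perm1 eqxx.
  rewrite s0 setC0 expr0 mul1r mulrC subn0; congr (_ * _).
  rewrite sym_char_hook // hook_char_coef ?s0 cards0 ?card_ord ?(leq_trans k0) //.
  have -> : cycles_of (1%g : 'S_n) = set0.
    by apply/cards0_eq/eqP; rewrite cycles_of_eq0 s0 cards0.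
  rewrite big_set0 mulr1 subn0 -(@coef_Xn_add1X n k 0 1 n.-1) ?expr0 ?mul1r //.
  by rewrite add0n add1n prednK // (leq_trans k0).
rewrite /= cards_eq0; apply/andP/eqP => [[_ /eqP s0]|->].
  apply/permP => x; rewrite perm1; apply/eqP; apply: contraTT isT => sx.
  by have : x \in supp s; [rewrite inE | rewrite s0 inE].
split; last by apply/eqP/setP => x; rewrite !inE perm1 eqxx.
by apply/forall_inP => x; rewrite inE perm1 eqxx.
Qed.

Lemma supp_term1 n k (e : rel 'I_n) r : supp_term k e 1 r = 0.
Proof.
rewrite /supp_term big_pred0 // => s; apply/andP => -[_ /eqP c1].
by move: (cycles_of_card_ge2 s) (cycles_of_eq0 s); rewrite c1; case: #|_|.
Qed.

(** The value at a transposition.  With k = j + 2 and n = p + 3 all binomial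
    coefficients are expressed through those of p at j - 1, j and j + 1, which are
    proportional; for k = 1 both sides are -1. *)
Lemma binom_over_predE n k : (1 <= k <= n)%N -> (3 <= n)%N ->
  binom (n%:Z - 3) (k%:Z - 3) - binom (n%:Z - 3) (k%:Z - 1) =
  (2 * k%:R - n%:R - 1) * binom_over_pred n k.
Proof.
move=> /andP[k0 lekn] n3; rewrite /binom_over_pred.
have -> : binom (n%:Z - 3) (k%:Z - 3) = if (3 <= k)%N then 'C(n - 3, k - 3)%:R
  else 0.
  exact: (@binomE n k 3 3).
have -> : binom (n%:Z - 3) (k%:Z - 1) = if (1 <= k)%N then 'C(n - 3, k - 1)%:R
  else 0.
  exact: (@binomE n k 3 1).
have -> : binom (n%:Z - 2) (k%:Z - 2) = if (2 <= k)%N then 'C(n - 2, k - 2)%:R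
  else 0.
  by apply: (@binomE n k 2 2); apply: ltnW.
case: eqVneq => [->|k1].
  rewrite /= subnn bin0.
  have nz : n%:R - 1 != 0 :> algC by rewrite subr_eq0 pnatr_eq1; lia.
  by field.
have {k1 k0} k2 : (2 <= k)%N by lia.
rewrite k2 (ltnW k2); pose j := (k - 2)%N; pose p := (n - 3)%N.
have Ek : k = j.+2 by rewrite /j; lia.
have En : n = p.+3 by rewrite /p; lia.
have lejp : (j <= p.+1)%N by lia.
rewrite En Ek !subSS !subn0; clearbody j p.
have nz : j.+2%:R - 1 != 0 :> algC by rewrite subr_eq0 pnatr_eq1.
apply: (mulIf nz); rewrite !mulrA mulfVK //.
(* Pascal's rule and the ratios of consecutive binomial coefficients; a stands
   for the coefficient at j - 1, which is 0 for j = 0. *)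
set a := if _ then _ else _.
have bE : j.+1%:R * 'C(p, j.+1)%:R = (p%:R - j%:R) * 'C(p, j)%:R :> algC.
  case: (leqP j p) => [le|lt]; last by rewrite !bin_small ?mulr0 // ltnW.
  by rewrite -natrB // -!natrM mul_bin_left.
have ME : 'C(p.+1, j)%:R = a + 'C(p, j)%:R :> algC.
  by rewrite /a; case: (j) => [|i]; rewrite ?bin0 ?add0r // binS natrD addrC subn1.
have aE : (p%:R + 1 - j%:R) * a = j%:R * 'C(p, j)%:R :> algC.
  rewrite /a; case: (j) lejp => [|i] lejp; first by rewrite mulr0 mul0r.
  have -> : p%:R + 1 - i.+1%:R = (p - i)%:R :> algC by rewrite natrB //; ring.
  by rewrite subn1 -!natrM mul_bin_left.
rewrite ME {ME}; apply/eqP; rewrite -subr_eq0; move: bE aE;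
  move: a 'C(p, j.+1)%:R 'C(p, j)%:R => a b c bE aE.
have -> : (a - b) * (j.+2%:R - 1) - (2 * j.+2%:R - p.+3%:R - 1) * (a + c) =
  ((p%:R + 1 - j%:R) * a - j%:R * c) - (j.+1%:R * b - (p%:R - j%:R) * c) by ring.
by rewrite aE bE !subrr.
Qed.

Lemma supp_term2 n k (e : rel 'I_n) r : symmetric e -> irreflexive e ->
  (1 <= k <= n)%N -> (3 <= n)%N ->
  supp_term k e 2 r =
  (2 * k%:R - n%:R - 1) * (matching_sum e r 1)%:R * binom_over_pred n k.
Proof.
move=> e_sym e_irr kn n3.
rewrite mulrAC -binom_over_predE // /supp_term /matching_sum natr_sum mulr_sumr
  muln1.
rewrite -(sum_transpositions (fun U =>
  (binom (n%:Z - 3) (k%:Z - 3) - binom (n%:Z - 3) (k%:Z - 1))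
  * (sym_deg e (r - 2) (~: U))%:R)) //.
apply: eq_bigr => s /andP[_ /eqP cs]; congr (_ * _).
rewrite (@sym_char_one_cycle n k s 2) // ?small_supp_one_cycle ?cs //.
by rewrite -signr_odd expr0 !mul1r.
Qed.

Lemma supp_term_one_cycle n k (e : rel 'I_n) l r : symmetric e -> irreflexive e ->
  (1 <= k <= n)%N -> (2 < l < n)%N ->
  \sum_(s : 'S_n | [&& along_edges e s, #|supp s| == l & #|cycles_of s| == 1%N])
     (-1) ^+ l * sym_char n (hook n k) s * (sym_deg e (r - l) (~: supp s))%:R =
  2 * (cycle_sum e r l)%:R *
    ((-1) ^+ l * binom (n%:Z - l.+1%:Z) (k%:Z - l.+1%:Z) -
       binom (n%:Z - l.+1%:Z) (k%:Z - 1)).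
Proof.
move=> e_sym e_irr kn /andP[l2 ln].
set v := _ - _; rewrite -mulrA mulr_natl /cycle_sum natr_sum mulr_suml -sumrMnl.
rewrite sumrMnl -(sum_one_cycles (fun U => (sym_deg e (r - l) (~: U))%:R * v)) //.
apply: eq_bigr => s /and3P[_ /eqP cs /eqP c1]; rewrite mulrC; congr (_ * _).
rewrite (@sym_char_one_cycle n k s l) // /v mulrBr.
by rewrite signrMK.
Qed.

Lemma supp_term3 n k (e : rel 'I_n) r : symmetric e -> irreflexive e ->
  (1 <= k <= n)%N -> (4 <= n)%N ->
  supp_term k e 3 r = - (2 * (cycle_sum e r 3)%:R *
     (binom (n%:Z - 4) (k%:Z - 4) + binom (n%:Z - 4) (k%:Z - 1))).
Proof.
move=> e_sym e_irr kn n4; rewrite -mulrN opprD.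
have := supp_term_one_cycle r e_sym e_irr kn (n4 : (2 < 3 < n)%N).
rewrite -{2}signr_odd expr1 mulN1r => <-.
apply: eq_bigl => s; case: eqVneq => cs; rewrite ?andbF ?andbT //.
by rewrite small_supp_one_cycle ?cs ?andbT.
Qed.

(** Besides the 4-cycles there are the products of two disjoint transpositions,
    which are the involutions moving four points. *)
Lemma supp_term4 n k (e : rel 'I_n) r : symmetric e -> irreflexive e ->
  (1 <= k <= n)%N -> (5 <= n)%N ->
  supp_term k e 4 r = 2 * (cycle_sum e r 4)%:R *
     (binom (n%:Z - 5) (k%:Z - 5) - binom (n%:Z - 5) (k%:Z - 1))
   + (matching_sum e r 2)%:R *
     (binom (n%:Z - 5) (k%:Z - 5) - 2 * binom (n%:Z - 5) (k%:Z - 3)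
      + binom (n%:Z - 5) (k%:Z - 1)).
Proof.
move=> e_sym e_irr kn n5; rewrite /supp_term (bigID (fun s : 'S_n =>
  #|cycles_of s| == 1%N)) /=.
congr (_ + _).
  have := supp_term_one_cycle r e_sym e_irr kn (n5 : (2 < 4 < n)%N).
  rewrite -{2}signr_odd expr0 mul1r => <-.
  by apply: eq_bigl => s; rewrite andbA.
set v := _ - _ + _; rewrite /matching_sum natr_sum mulr_suml.
rewrite -(@sum_involutions_matchings _ _ 2%N _ (fun U =>
  (sym_deg e (r - 2 * 2) (~: U))%:R * v)) //.
have two (s : 'S_n) : #|supp s| = 4%N -> #|cycles_of s| != 1%N ->
  #|cycles_of s| = 2%N.
  by move=> cs; move: (cycles_of_card_ge2 s) (cycles_of_eq0 s); rewrite cs;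
    case: #|_| => [|[|[|m]]].
apply: eq_big => [s|s /andP[/andP[_ /eqP cs] /(two _ cs) c2]]; last first.
  rewrite mulrC; congr (_ * _).
  rewrite (@sym_char_two_cycles n k s 2) // -signr_odd expr0 !mul1r /v.
  rewrite -[5 : int]/(5%:Z) -[3 : int]/(3%:Z); ring.
rewrite -andbA; congr (_ && _); apply/andP/andP => -[/eqP cs H]; split;
  rewrite ?cs //.
  have c2 := two s cs H; apply/eqP/permP => x; rewrite perm1 -expg2.
  case: (boolP (x \in supp s)) => xs; last exact: out_supp_expg.
  move: xs; rewrite -cover_cycles_of => /bigcupP[O Os xO].
  suff <- : #|O| = 2%N by apply: mem_cycles_of_period xO.
  have := sum_card_cycles_of s; rewrite cs (big_setD1 O) //=.
  have : (#|cycles_of s :\ O| * 2 <= \sum_(Q in cycles_of s :\ O) #|Q|)%N.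
    rewrite -sum_nat_const; apply: leq_sum => Q; rewrite !inE => /and3P[_ _].
    by [].
  have := cardsD1 O (cycles_of s); rewrite Os c2 add1n => -[<-].
  move: Os; rewrite inE => /andP[_]; move: (\sum_(Q in _) _)%N #|O| => a b; lia.
apply/eqP => c1; have /set0Pn[x xs] : supp s != set0 by rewrite -card_gt0 cs.
have ss : s (s x) = x by rewrite -permM (eqP H) perm1.
by have := porbit_period2 ss; rewrite one_cycle_porbit // cs.
Qed.

Lemma cycle_sum_diag n (e : rel 'I_n) l : cycle_sum e l l = #|cycles e l|.
Proof.
by rewrite /cycle_sum -sum1_card; apply: eq_bigr => C _; rewrite subnn sym_deg0.
Qed.

Lemma supp_term5 n k (e : rel 'I_n) : symmetric e -> irreflexive e ->
  (1 <= k <= n)%N -> (6 <= n)%N ->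
  supp_term k e 5 5 =
   - (2 * #|cycles e 5|%:R * (binom (n%:Z - 6) (k%:Z - 6) + binom (n%:Z - 6)
     (k%:Z - 1)))
   - \sum_(T in cycles e 3)
       2 * (#|edges e|%:R + 3 - (deg_sum e T)%:R)
       * (binom (n%:Z - 6) (k%:Z - 6) + binom (n%:Z - 6) (k%:Z - 3)
          - binom (n%:Z - 6) (k%:Z - 4) - binom (n%:Z - 6) (k%:Z - 1)).
Proof.
move=> e_sym e_irr kn n6; rewrite /supp_term (bigID (fun s : 'S_n =>
  #|cycles_of s| == 1%N)) /=.
congr (_ + _).
  have := supp_term_one_cycle 5 e_sym e_irr kn (n6 : (2 < 5 < n)%N).
  rewrite cycle_sum_diag -{2}signr_odd expr1 mulN1r -opprD mulrN => <-.
  by apply: eq_bigl => s; rewrite andbA.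
set v := _ + _ - _ - _; rewrite -mulr_suml -mulr_sumr.
have two (s : 'S_n) : #|supp s| = 5%N ->
  (#|cycles_of s| != 1%N) = (#|cycles_of s| == 2%N).
  by move=> cs; move: (cycles_of_card_ge2 s) (cycles_of_eq0 s); rewrite cs;
    case: #|_| => [|[|[|m]]].
rewrite (eq_bigr (fun=> - v)) => [|s /andP[/andP[_ /eqP cs]]]; last first.
  rewrite two // => /eqP c2; rewrite subnn sym_deg0 mulr1.
  rewrite (@sym_char_two_cycles n k s 3) // -[in (-1) ^+ 3]signr_odd -signr_odd
    !expr1 !mulN1r /v.
  rewrite -[6 : int]/(6%:Z) -[4 : int]/(4%:Z) -[3 : int]/(3%:Z); ring.
rewrite (eq_bigl (fun s => s \in [set s : 'S_n | [&& along_edges e s, #|supp s|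
  == 5%N & #|cycles_of s| == 2%N]])) => [|s]; last first.
  by rewrite inE -andbA; case: eqVneq => cs; rewrite ?andbF ?andFb // two.
rewrite sumr_const card_type32 // mulNrn; congr (- _).
rewrite -[v *+ _]mulr_natl natrM natr_sum; congr (_ * _ * _).
apply: eq_bigr => C CC; apply: (addIr (deg_sum e C)%:R).
by rewrite subrK -!natrD card_edges_off_triangle.
Qed.

(** * The first six coefficients *)

Theorem corollary6p1 (n k : nat) (e : rel 'I_n) (c : nat -> algC)
    (e_sym : symmetric e) (e_irr : irreflexive e)
    (hk : (1 <= k <= n)%N)
    (hc : immanant (hook n k) (char_poly_mx (laplacian e)) =
          \sum_(r < n.+1) ((-1) ^+ r * c r) *: 'X^(n - r)) :
  let N : int := n%:Z in
  let K : int := k%:Z in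
  let m : nat := #|edges e| in
  let F (r : nat) : algC := (sym_deg e r [set: 'I_n])%:R in
  let cyc (l : nat) : algC := #|cycles e l|%:R in
  let CS (r l : nat) : algC := (cycle_sum e r l)%:R in
  let MS (r l : nat) : algC := (matching_sum e r l)%:R in
  [/\ c 0%N = binom (N - 1) (K - 1),
      c 1%N = F 1%N * binom (N - 1) (K - 1) /\
      c 1%N = 2 * m%:R * binom (N - 1) (K - 1),
      (3 <= n)%N ->
      c 2%N = F 2%N * binom (N - 1) (K - 1)
        + (2 * k%:R - n%:R - 1) * m%:R * binom_over_pred n k,
      (4 <= n)%N ->
      c 3%N = F 3%N * binom (N - 1) (K - 1)
        + (2 * k%:R - n%:R - 1) * MS 3%N 1%N * binom_over_pred n k
        - 2 * cyc 3%N * (binom (N - 4) (K - 4) + binom (N - 4) (K - 1)) &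
      ((5 <= n)%N ->
       c 4%N = F 4%N * binom (N - 1) (K - 1)
        + (2 * k%:R - n%:R - 1) * MS 4%N 1%N * binom_over_pred n k
        - 2 * CS 4%N 3%N * (binom (N - 4) (K - 4) + binom (N - 4) (K - 1))
        + 2 * cyc 4%N * (binom (N - 5) (K - 5) - binom (N - 5) (K - 1))
        + (binom m 2 - \sum_(i < n) binom (deg e i) 2)
          * (binom (N - 5) (K - 5) - 2 * binom (N - 5) (K - 3)
             + binom (N - 5) (K - 1)))
      /\
      ((6 <= n)%N ->
       c 5%N = F 5%N * binom (N - 1) (K - 1)
        + (2 * k%:R - n%:R - 1) * MS 5%N 1%N * binom_over_pred n k
        - 2 * CS 5%N 3%N * (binom (N - 4) (K - 4) + binom (N - 4) (K - 1))
        + 2 * CS 5%N 4%N * (binom (N - 5) (K - 5) - binom (N - 5) (K - 1))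
        + MS 5%N 2%N
          * (binom (N - 5) (K - 5) - 2 * binom (N - 5) (K - 3)
             + binom (N - 5) (K - 1))
        - 2 * cyc 5%N * (binom (N - 6) (K - 6) + binom (N - 6) (K - 1))
        - \sum_(T in cycles e 3)
            2 * (m%:R + 3 - (deg_sum e T)%:R)
            * (binom (N - 6) (K - 6) + binom (N - 6) (K - 3)
               - binom (N - 6) (K - 4) - binom (N - 6) (K - 1)))].
Proof.
move=> N K m F cyc CS MS.
have n1 : (1 <= n)%N by have /andP[k1] := hk; apply: leq_trans.
have cE r : (r <= n)%N -> c r = \sum_(t < r.+1) supp_term k e t r.
  exact: coef_immanant_laplacian.
have t0 r : supp_term k e 0 r = F r * binom (N - 1) (K - 1) by apply: supp_term0.
have cyc3 : CS 3%N 3%N = cyc 3%N by rewrite /CS cycle_sum_diag.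
have cyc4 : CS 4%N 4%N = cyc 4%N by rewrite /CS cycle_sum_diag.
have F0 : F 0%N = 1 by rewrite /F sym_deg0.
have MS2 : MS 2%N 1%N = m%:R.
  rewrite /MS /matching_sum (eq_bigr (fun=> 1%N)) => [|M _]; last exact: sym_deg0.
  by rewrite (big_matchings1 (fun=> 1%N)) // sum1_card.
have MS4 : MS 4%N 2%N = binom m 2 - \sum_(i < n) binom (deg e i) 2.
  rewrite /MS /matching_sum (eq_bigr (fun=> 1%N)) => [|M _]; last exact: sym_deg0.
  rewrite sum1_card; apply: (addIr (\sum_(i < n) binom (deg e i) 2)); rewrite subrK.
  by rewrite /binom /= -natr_sum -natrD card_matchings2.
have c1 : c 1%N = F 1%N * binom (N - 1) (K - 1).
  by rewrite cE // !big_ord_recr big_ord0 /= supp_term1 add0r addr0 t0.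
split.
- by rewrite cE // big_ord_recr big_ord0 /= add0r t0 F0 mul1r.
- by split=> //; rewrite c1 /F handshake // natrM.
- move=> n3; rewrite cE; last exact: leq_trans n3.
  by rewrite !big_ord_recr big_ord0 /= supp_term1 add0r addr0 t0 supp_term2 // -MS2.
- move=> n4; rewrite cE; last exact: leq_trans n4.
  rewrite !big_ord_recr big_ord0 /= supp_term1 add0r addr0 t0 supp_term2 ?(ltnW n4) //.
  by rewrite supp_term3 // -cyc3.
split=> [n5|n6].
  rewrite cE ?(ltnW n5) // !big_ord_recr big_ord0 /= supp_term1 add0r addr0 t0.
  rewrite supp_term2 ?(ltnW (ltnW n5)) // supp_term3 ?(ltnW n5) // supp_term4 //.
  by rewrite -cyc4 -MS4 !addrA.
rewrite cE ?(ltnW n6) // !big_ord_recr big_ord0 /= supp_term1 add0r addr0 t0.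
rewrite supp_term2 ?(ltnW (ltnW (ltnW n6))) // supp_term3 ?(ltnW (ltnW n6)) //.
by rewrite supp_term4 ?(ltnW n6) // supp_term5 // !addrA.
Qed.
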